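(* Let $n\in\mathbb{N}$. For $p\in\mathbb{N}_0$, the tensorial measure valued valuations $$Q^m\phi_j^{r,s,l}:\mathcal{P}^n\times\mathcal{B}(\mathbb{R}^n)\to\mathbb{T}^p,\qquad (P,\beta)\mapsto Q^m\,\phi_j^{r,s,l}(P,\beta),$$ with $m,r,s,l\in\mathbb{N}_0$ and $j\in\{0,\dots,n\}$, where $2m+2l+r+s=p$, but with $l=0$ if $j\in\{0,n-1\}$ and with $s=l=0$ if $j=n$, are linearly independent (over $\mathbb{R}$).
   Context: Notation. $\mathbb{R}^n$, $n\in\mathbb{N}$, is the $n$-dimensional Euclidean space with scalar product $\langle\cdot,\cdot\rangle$. $\mathcal{P}^n$ is the set of (nonempty) convex polytopes in $\mathbb{R}^n$, $\mathcal{B}(\mathbb{R}^n)$ the Borel $\sigma$-algebra, $\mathcal{H}^j$ the $j$-dimensional Hausdorff measure, $\mathbb{S}^{n-1}$ the Euclidean unit sphere in $\mathbb{R}^n$, and $\omega_m=2\pi^{m/2}/\Gamma(m/2)$ the $(m-1)$-dimensional volume of the unit sphere in $\mathbb{R}^m$. Tensors. $\mathbb{T}^p$ is the vector space of symmetric tensors of rank $p$ over $\mathbb{R}^n$; with $\mathbb{R}^n$ identified with its dual via the scalar product, these are the symmetric $p$-linear maps $(\mathbb{R}^n)^p\to\mathbb{R}$. Products and powers of tensors are symmetric tensor products; $x^r$ is the $r$-fold tensor power of $x\in\mathbb{R}^n$; zeroth powers equal $1$. The metric tensor is $Q\in\mathbb{T}^2$, $Q(x,y)=\langle x,y\rangle$.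 For a face $F$ of a polytope with direction space $F^0$ (the linear subspace parallel to the affine hull of $F$), $Q(F)(x,y):=\langle p_{F^0}(x),p_{F^0}(y)\rangle$, where $p_{F^0}$ is the orthogonal projection onto $F^0$. Generalized tensorial curvature measures. For $P\in\mathcal{P}^n$, let $\mathcal{F}_j(P)$ be the set of $j$-dimensional faces of $P$ and $N(P,F)$ the normal cone of $P$ at $F$. For $j\in\{0,\dots,n-1\}$, $r,s,l\in\mathbb{N}_0$ and $\beta\in\mathcal{B}(\mathbb{R}^n)$, $$\phi_j^{r,s,l}(P,\beta):=c_{n,j}^{r,s,l}\frac{1}{\omega_{n-j}}\sum_{F\in\mathcal{F}_j(P)}Q(F)^l\int_{F\cap\beta}x^r\,\mathcal{H}^j(\mathrm{d}x)\int_{N(P,F)\cap\mathbb{S}^{n-1}}u^s\,\mathcal{H}^{n-j-1}(\mathrm{d}u),$$ where $c_{n,j}^{r,s,l}:=\frac{1}{r!\,s!}\frac{\omega_{n-j}}{\omega_{n-j+s}}\frac{\omega_{j+2l}}{\omega_j}$ if $j\ne0$, $c_{n,0}^{r,s,0}:=\frac{1}{r!\,s!}\frac{\omega_n}{\omega_{n+s}}$, and $c_{n,0}^{r,s,l}:=1$ for $l\ge1$. For $j=n$ and $r,l\in\mathbb{N}_0$, $$\phi_n^{r,0,l}(P,\beta):=\frac{1}{r!}\frac{\omega_{n+2l}}{\omega_n}\,Q^l\int_{P\cap\beta}x^r\,\mathcal{H}^n(\mathrm{d}x).$$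
   Formalization: For n = 1 the theorem is stated only for p ≤ 1, because for n = 1 and p ≥ 2 the claim fails: every u in S^0 satisfies u² = Q, so φ_0^{p-2,2,0} is a constant multiple of Q φ_0^{p-2,0,0}. *)

(* Defs.v *)
From HB Require Import structures.
From mathcomp Require Import all_boot all_order all_fingroup all_algebra.
From mathcomp Require Import all_classical all_reals all_analysis.

Unset Printing Implicit Defensive.

Import Order.TTheory GRing.Theory Num.Theory.
Import numFieldNormedType.Exports.

Local Open Scope classical_set_scope.
Local Open Scope ring_scope.

Section constants.
Variable R : realType.

Definition Gamma (x : R) : R :=
  \int[lebesgue_measure]_(t in `]0, +oo[) (t `^ (x - 1) * expR (- t)).

(* surface area of the unit sphere of R^m *)
Definition omega (m : nat) : R :=
  2 * pi `^ (m%:R / 2) / Gamma (m%:R / 2).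

(* volume of the unit ball of R^m *)
Definition kappa (m : nat) : R :=
  pi `^ (m%:R / 2) / Gamma (m%:R / 2 + 1).

End constants.

(* The library norm on 'rV[R]_n is the sup norm, which induces the right
   topology but not the Euclidean metric needed below. *)
Section euclidean.
Context {R : realType} {n : nat}.
Local Notation E := 'rV[R]_n.

Definition dotv (x y : E) : R := \sum_i x 0 i * y 0 i.

Definition enorm (x : E) : R := Num.sqrt (dotv x x).

Definition usphere : set E := [set x | enorm x = 1].

Definition borelE : Type := g_sigma_algebraType (@open E).
HB.instance Definition _ := Measurable.on borelE.

Definition borel_set := {B : set borelE | measurable B}.

Definition ediam (A : set E) : \bar R :=
  ereal_sup [set (enorm (xy.1 - xy.2))%:E | xy in A `*` A].

Definition oproj (V : {vspace E}) (x : E) : E :=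
  xget 0 [set y | y \in V /\ forall z, z \in V -> dotv (x - y) z = 0].

Lemma oprojP (V : {vspace E}) (x : E) :
  oproj V x \in V /\ forall z, z \in V -> dotv (x - oproj V x) z = 0.
Proof.
suff [y Vy] : exists y, [set y | y \in V /\
    forall z, z \in V -> dotv (x - y) z = 0] y
  by rewrite /oproj; case: xgetP => [_ -> //|/(_ y)].
pose f (u : E) := \row_(i < \dim V) dotv u (vbasis V)`_i.
have f_lin : linear f.
  move=> a u v; apply/rowP => i; rewrite !mxE /dotv mulr_sumr -big_split /=.
  by apply: eq_bigr => k _; rewrite !mxE mulrDl mulrA.
pose fL := GRing.isLinear.Build _ _ _ _ f f_lin.
pose F : {linear E -> 'rV[R]_(\dim V)} := HB.pack f fL.
have orth u : f u = 0 -> forall z, z \in V -> dotv u z = 0.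
  move=> fu0 z /coord_vbasis ->; rewrite /dotv.
  transitivity (\sum_i coord (vbasis V) i z * dotv u (vbasis V)`_i).
    rewrite /dotv; under [RHS]eq_bigr do rewrite mulr_sumr.
    rewrite exchange_big /=; apply: eq_bigr => k _.
    rewrite summxE mulr_sumr; apply: eq_bigr => i _.
    by rewrite !mxE mulrCA.
  rewrite big1 // => i _; move/rowP/(_ i): fu0; rewrite !mxE => ->.
  exact: mulr0.
have ker0 : (V :&: lker (linfun F) = 0)%VS.
  apply/eqP; rewrite -subv0; apply/subvP => u; rewrite memv_cap memv_ker lfunE /=.
  move=> /andP[Vu /eqP fu0]; have /eqP := orth _ fu0 _ Vu; rewrite /dotv.
  rewrite psumr_eq0 => [/allP u0|i _]; last by rewrite -expr2 sqr_ge0.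
  rewrite memv0; apply/eqP/rowP => i; rewrite mxE.
  by have := u0 i (mem_index_enum i); rewrite /= mulf_eq0 orbb => /eqP.
have fV : (linfun F @: V = fullv)%VS.
  by apply/eqP; rewrite eqEdim subvf limg_dim_eq // dimvf /dim /= mul1n.
have /memv_imgP[y Vy] : linfun F x \in (linfun F @: V)%VS by rewrite fV memvf.
rewrite !lfunE /= => fxy; exists y; split => //; apply: orth.
have -> : f (x - y) = F (x - y) by [].
by rewrite linearB /= fxy subrr.
Qed.

End euclidean.
Arguments borelE R n : clear implicits.
Arguments borel_set R n : clear implicits.

Section hausdorff.
Context {R : realType} {n : nat}.
Local Notation E := 'rV[R]_n.
Local Open Scope ereal_scope.

(* Without the case distinction the empty set would have gauge 1 for j = 0. *)
Definition hausdorff_gauge (j : nat) (A : set E) : \bar R :=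
  if A == set0 then 0 else (kappa R j * (fine (ediam A) / 2) ^+ j)%:E.

Definition hausdorff_pre (j : nat) (delta : R) (A : set E) : \bar R :=
  ereal_inf [set \sum_(k <oo) hausdorff_gauge j (C k) |
    C in [set C : (set E)^nat |
      A `<=` \bigcup_k C k /\ forall k, ediam (C k) <= delta%:E]].

(* Outer measure normalised so that H^n is Lebesgue measure on R^n.
   It is only ever integrated over the Borel sigma-algebra. *)
Definition hausdorff (j : nat) (A : set (borelE R n)) : \bar R :=
  ereal_sup [set hausdorff_pre j delta A | delta in [set d : R | (0 < d)%R]].

End hausdorff.

Section polytopes.
Context {R : realType} {n : nat}.
Local Notation E := 'rV[R]_n.

Definition conv_hull (s : seq E) : set E :=
  [set x | exists w : 'I_(size s) -> R,
    [/\ forall i, 0 <= w i, \sum_i w i = 1 & x = \sum_i w i *: s`_i]].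

Definition is_polytope (P : set E) : Prop :=
  exists s : seq E, s != [::] /\ P = conv_hull s.

Definition polytope := {P : set E | is_polytope P}.

Definition is_direction (F : set E) (V : {vspace E}) : Prop :=
  (forall x y, F x -> F y -> x - y \in V) /\
  forall W : {vspace E}, (forall x y, F x -> F y -> x - y \in W) -> (V <= W)%VS.

(* F^0, the linear subspace parallel to the affine hull of F *)
Definition direction (F : set E) : {vspace E} :=
  xget 0%VS [set V | is_direction F V].

Lemma directionP (F : set E) : is_direction F (direction F).
Proof.
suff [V FV] : exists V, [set V | is_direction F V] V
  by rewrite /direction; case: xgetP => [_ -> //|/(_ V)].
pose D (V : {vspace E}) := forall x y, F x -> F y -> x - y \in V.
have exD : exists k, `[< exists2 V, D V & \dim V = k >].
  by exists (\dim {:E}); apply/asboolP; exists fullv => // x y _ _; exact: memvf.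
case: (ex_minnP exD) => k /asboolP[V DV dV] kmin.
exists V; split => // W DW; apply/capv_idPl/eqP.
rewrite eqEdim capvSl dV kmin //; apply/asboolP; exists (V :&: W)%VS => //.
by move=> x y Fx Fy; rewrite memv_cap DV // DW.
Qed.

Definition face (P F : set E) : Prop :=
  [/\ F !=set0, F `<=` P, convex_set (M := E) F &
    forall x y (t : R), P x -> P y -> 0 < t < 1 ->
      F (t *: x + (1 - t) *: y) -> F x /\ F y].

Definition faces (j : nat) (P : set E) : set (set E) :=
  [set F | face P F /\ \dim (direction F) = j].

Definition normal_cone (P F : set E) : set E :=
  [set u | forall x y, F x -> P y -> dotv u (y - x) <= 0].

End polytopes.
Arguments polytope R n : clear implicits.

Section tensors.
Context {R : realType} {n : nat}.
Local Notation E := 'rV[R]_n.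

(* The ambient space of all real functions of p vectors.  The symmetric
   tensors T^p form its linear subspace of symmetric multilinear functions;
   linear independence does not depend on which of the two is the codomain. *)
Definition tensor (p : nat) : Type := ('I_p -> E) -> R^o.
HB.instance Definition _ p := GRing.Lmodule.on (tensor p).

Definition tcast {p q : nat} (e : p = q) (a : tensor p) : tensor q :=
  fun v => a (fun i => v (cast_ord e i)).

Definition tone : tensor 0 := fun _ => 1.

(* the symmetric tensor product, i.e. the symmetrisation of a (x) b *)
Definition tmul {p q : nat} (a : tensor p) (b : tensor q) : tensor (p + q) :=
  fun v => (p + q)`!%:R^-1 * \sum_(sigma : 'S_(p + q))
    (a (fun i => v (sigma (lshift q i))) * b (fun i => v (sigma (rshift p i)))).

Fixpoint tpow {p : nat} (a : tensor p) (k : nat) : tensor (k * p) :=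
  match k return tensor (k * p) with
  | 0 => tone
  | k'.+1 => tmul a (tpow a k')
  end.

Definition vpow (x : E) (r : nat) : tensor r :=
  fun v => \prod_i dotv x (v i).

Definition metric : tensor 2 := fun v => dotv (v ord0) (v ord_max).

Definition face_metric (F : set E) : tensor 2 := fun v =>
  dotv (oproj (direction F) (v ord0)) (oproj (direction F) (v ord_max)).

(* the tensor-valued integral over A of x^r with respect to H^j *)
Definition moment (j : nat) (A : set (borelE R n)) (r : nat) : tensor r :=
  fun v => fine (\int[hausdorff j]_(x in A) (vpow x r v)%:E)%E.

End tensors.
Arguments tensor R n p : clear implicits.

Section curvature_measures.
Context {R : realType} {n : nat}.
Local Notation E := 'rV[R]_n.

Definition coef (j r s l : nat) : R :=
  if j == 0%N then
    if l == 0%N then (r`! * s`!)%:R^-1 * (omega R n / omega R (n + s)) else 1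
  else (r`! * s`!)%:R^-1 * (omega R (n - j) / omega R (n - j + s))
       * (omega R (j + 2 * l) / omega R j).

(* The finitely supported sum is genuine: a polytope has finitely many faces. *)
Definition phi_lower (j r s l : nat) (P : set E) (B : set (borelE R n)) :
    tensor R n (l * 2 + (r + s)) :=
  (coef j r s l / omega R (n - j)) *:
  \sum_(F \in faces j P)
    tmul (tpow (face_metric F) l)
      (tmul (moment j (F `&` B) r)
            (moment (n - j - 1) (normal_cone P F `&` usphere) s)).

Definition phi_top (r l : nat) (P : set E) (B : set (borelE R n)) :
    tensor R n (l * 2 + r) :=
  (r`!%:R^-1 * (omega R (n + 2 * l) / omega R n)) *:
  tmul (tpow metric l) (moment n (P `&` B) r).

(* phi_n^{r,s,l} is only defined for s = 0; the value 0 for s > 0 is a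
   placeholder, excluded by admissible below. *)
Definition phi (j r s l : nat) (P : set E) (B : set (borelE R n)) :
    tensor R n (l * 2 + (r + s)) :=
  if (j < n)%N then phi_lower j r s l P B else
  match s return tensor R n (l * 2 + (r + s)) with
  | 0 => tcast (congr1 (addn (l * 2)) (esym (addn0 r))) (phi_top r l P B)
  | _.+1 => 0
  end.

Definition Qphi (m j r s l : nat) (P : set E) (B : set (borelE R n)) :
    tensor R n (m * 2 + (l * 2 + (r + s))) :=
  tmul (tpow metric m) (phi j r s l P B).

(* the tuples (m, j, r, s, l) *)
Definition admissible (p : nat) (t : nat * nat * nat * nat * nat) : bool :=
  let: (m, j, r, s, l) := t in
  [&& 2 * m + 2 * l + r + s == p, j <= n,
      ((j == 0) || (j == n - 1)) ==> (l == 0)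
    & (j == n) ==> ((s == 0) && (l == 0))]%N.

Definition index (p : nat) := {t | admissible p t}.

Lemma admissible_rank {p m j r s l} :
  admissible p (m, j, r, s, l) -> (m * 2 + (l * 2 + (r + s)) = p)%N.
Proof. by case/and4P => /eqP <- _ _ _; rewrite ![(2 * _)%N]mulnC !addnA. Qed.

Definition Qphi_family (p : nat) (i : index p) :
    polytope R n -> borel_set R n -> tensor R n p :=
  let: exist (m, j, r, s, l) h := i in
  fun P B => tcast (admissible_rank h) (Qphi m j r s l (sval P) (sval B)).

End curvature_measures.
Arguments index n p : clear implicits.
Arguments Qphi_family R n p i : clear implicits.

(* a family is linearly independent if each of its finite subfamilies is *)
Definition linearly_independent {K : nzRingType} {V : lmodType K}
    {I : eqType} (f : I -> V) : Prop :=
  forall (s : seq I) (a : I -> K), uniq s ->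
    \sum_(i <- s) a i *: f i = 0 -> forall i, i \in s -> a i = 0.

(* Main.v *)
From HB Require Import structures.
Require Import Defs.
From mathcomp Require Import all_boot all_order all_fingroup all_algebra.
From mathcomp Require Import all_classical all_reals all_analysis.
From mathcomp Require Import measurable_realfun zify ring lra.

(** Suppose a linear combination of the valuations vanishes, and let [j] be the
    largest face dimension that occurs with a nonzero coefficient.  Evaluate the
    combination at a polytope [P] with a [j]-dimensional face [F] and at a small
    Borel set [B] in the relative interior of [F].  Faces of dimension less than
    [j] do not meet [B], the valuations that involve faces of larger dimension
    have coefficient [0], and [F] is the only [j]-dimensional face that meets [B]
    ([face_meeting_box]).  A symmetric tensor evaluated at [(y, ..., y)] is a
    homogeneous polynomial in [y], and symmetric products become products
    ([tmul_diag]).  For a unit vector [y], with [p] the projection onto the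
    direction of [F], what remains is a sum of terms
    [a * c * |p y| ^ (2 l) * I_r * J_s], where [c] is a nonzero constant, [I_r] is
    the integral of [<x, y> ^ r] over [B], and [J_s] is the integral of
    [<u, y> ^ s] over the unit vectors of the normal cone of [P] at [F].

    The polytopes are explicit: for every [j], every point [x0] and every opening
    [eta], a wedge whose face [F] is a [j]-dimensional cross-polytope centred at
    [x0] and whose normal cone at [F] is a polyhedral cone of width [eta] around
    the coordinate axis [j] ([normal_cone_wedge_edge]).  When [B] shrinks to [x0]
    and the cone to its axis, the integrals divided by the measures of their
    domains tend to [<x0, y> ^ r] and [y_j ^ s] ([average_pow_cvg]), which leaves
    a polynomial identity ([vanishing_limit]).  Unit vectors [y] and points [x0]
    can be chosen with [|p y| = t], [y_j = t ^ K] and [<x0, y> = t ^ (K * K)]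
    ([exists_test_vector]), so that the term of index [(r, s, l)] becomes
    [t ^ (2 l + K (s + K r))].  For [K] larger than the rank the exponents are
    distinct, and all coefficients in dimension [j] vanish.  In the boundary cases
    [j = 0], [j = n - 1] and [j = n] fewer directions are available for [y], but
    [l = 0] there, and also [s = 0] when [j = n]; on the line the rank is at
    most [1].

    The passage to the limit only requires that the boxes and the spherical caps
    have positive and finite Hausdorff measure, not its exact value.  Finiteness
    is a count of grid cells ([hausdorff_lty]); positivity follows from
    compactness and a count of lattice points ([hausdorff_gt0]).  That Hausdorff
    measure is countably additive on Borel sets is Caratheodory's criterion for
    outer measures that are additive on sets at positive distance
    ([closed_caratheodory]).  Finally the normalising constants are nonzero since
    Gamma is finite and positive on the positive half-line ([Gamma_gt0]). *)

Set Implicit Arguments.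
Unset Strict Implicit.
Unset Printing Implicit Defensive.

Import Order.TTheory GRing.Theory Num.Theory.
Import numFieldNormedType.Exports.

Local Open Scope classical_set_scope.
Local Open Scope ring_scope.

(** * Positivity of the constants *)

Section gamma_function.
Context {R : realType}.
Local Notation mu := (@lebesgue_measure R).

Definition Gamma_integrand (x t : R) : R := t `^ (x - 1) * expR (- t).

Lemma Gamma_integrand_ge0 x t : 0 <= Gamma_integrand x t.
Proof. by rewrite mulr_ge0 ?powR_ge0 ?expR_ge0. Qed.

Lemma measurable_Gamma_integrand x (D : set R) :
  measurable_fun D (Gamma_integrand x : _ -> R).
Proof.
apply: (@measurable_funS _ _ _ _ setT) => //.
apply: measurable_funM; first exact: measurable_powR.
exact: measurableT_comp.
Qed.

(** The function [(t / (1 + t)) ^ x] is bounded, and its derivative behaves like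
    [t ^ (x - 1)] at [0] while decaying only polynomially at infinity.  It
    therefore dominates the integrand of [Gamma x] at both ends of the half-line
    and gives finiteness with a single primitive. *)
Definition ratio_powR (x t : R) : R := (t / (1 + t)) `^ x.

Definition ratio_powR' (x t : R) : R :=
  x * (t / (1 + t)) `^ (x - 1) * (1 + t)^-2.

Lemma is_derive_ratio_powR (x t : R) : 0 < t ->
  is_derive t 1 (ratio_powR x) (ratio_powR' x t).
Proof.
move=> t0; have t1 : 1 + t != 0 by rewrite gt_eqF // addr_gt0.
have tt0 : 0 < t / (1 + t) by rewrite divr_gt0 // addr_gt0.
have dq : is_derive t (1 : R) (fun s : R => s / (1 + s)) ((1 + t)^-2).
  have d1 : is_derive t (1 : R) (fun s : R => 1 + s : R^o) (0 + 1 : R).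
    exact: (@is_deriveD R R^o R^o (cst 1) id t 1 0 1 (is_derive_cst _ _ _)
      (is_derive_id _ _)).
  have dV := is_deriveV _ d1.
  have d2 := is_deriveM (is_derive_id t (1 : R)) (dV t1).
  apply: (is_derive_eq d2); rewrite /GRing.scale /= add0r !mulr1.
  by field.
exact: (@is_derive1_comp R (fun u => powR u x) (fun s : R => s / (1 + s)) t _ _
  (@is_derive1_powR R x _ tt0) dq).
Qed.

(** After cancelling [t ^ (x - 1)] this is [(1 + t) ^ (x + 1) <= C * expR t],
    the [(x + 1)]-st power of [1 + t <= (x + 1) * expR (t / (x + 1))]. *)
Lemma Gamma_integrand_le (x t : R) : 0 < x -> 0 < t ->
  Gamma_integrand x t <= (x + 1) `^ (x + 1) / x * ratio_powR' x t.
Proof.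
move=> x0 t0.
have t1 : 0 < 1 + t by rewrite addr_gt0.
have x1 : 0 < x + 1 by rewrite addr_gt0.
have et : (1 + t) `^ (x + 1) <= (x + 1) `^ (x + 1) * expR t.
  have -> : expR t = expR (t / (x + 1)) `^ (x + 1).
    by rewrite -expRM divfK ?gt_eqF.
  rewrite -(@powRM _ (x + 1)) ?expR_ge0 ?(ltW x1) //.
  apply: (ge0_ler_powR (ltW x1)); rewrite ?nnegrE ?mulr_ge0 ?expR_ge0 ?ltW //.
  have := expR_ge1Dx (t / (x + 1)).
  rewrite -(ler_pM2l x1) mulrDr mulrCA divff ?gt_eqF // !mulr1; lra.
have -> : ratio_powR' x t = x * (t `^ (x - 1) / (1 + t) `^ (x + 1)).
  rewrite /ratio_powR' -mulrA; congr (_ * _).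
  rewrite powRM ?invr_ge0 ?ltW // -mulrA; congr (_ * _).
  rewrite -powR_inv1 ?ltW // -powRrM mulN1r -(@powR_mulrn _ _ 2) ?ltW //.
  rewrite -!powRN -powRD; last by rewrite (gt_eqF t1) implybT.
  by congr (_ `^ _); ring.
rewrite mulrA divfK ?gt_eqF // mulrCA ler_wpM2l ?powR_ge0 //.
by rewrite ler_pdivlMr ?powR_gt0 // mulrC expRN ler_pdivrMr ?expR_gt0.
Qed.

Lemma ratio_powR_bounds (x t : R) : 0 < x -> 0 < t -> 0 <= ratio_powR x t <= 1.
Proof.
move=> x0 t0; have t1 : 0 < 1 + t by rewrite addr_gt0.
rewrite powR_ge0 /=; apply: (@le_trans _ _ (1 `^ x)); last by rewrite powR1.
apply: (ge0_ler_powR (ltW x0)).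
- by rewrite nnegrE divr_ge0 ?ltW.
- by rewrite nnegrE.
- by rewrite ler_pdivrMr // mul1r lerDr.
Qed.

Lemma derivable_ratio_powR (x t : R) : 0 < t -> derivable (ratio_powR x) t 1.
Proof. by move=> /(is_derive_ratio_powR x) d; exact: ex_derive. Qed.

Lemma continuous_ratio_powR (x t : R) :
  0 < t -> {for t, continuous (ratio_powR x)}.
Proof.
move=> t0; apply/differentiable_continuous/derivable1_diffP.
exact: derivable_ratio_powR.
Qed.

Lemma continuous_ratio_powR' (x a b : R) : 0 < a ->
  {within `[a, b], continuous (ratio_powR' x)}.
Proof.
move=> a0; apply: continuous_in_subspaceT => t.
rewrite inE /= in_itv /= => /andP[ta _]; have t0 := lt_le_trans a0 ta.
apply: cvgM.
  by apply: cvgM; [exact: cvg_cst | exact: continuous_ratio_powR].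
apply: cvgV; first by rewrite expf_neq0 // gt_eqF // addr_gt0.
have c1 : (1 + z : R) @[z --> t] --> 1 + t.
  by apply: cvgD; [exact: cvg_cst | exact: cvg_id].
exact: (cvgM c1 c1).
Qed.

Lemma measurable_ratio_powR' (x a b : R) : 0 < a ->
  measurable_fun `[a, b] (ratio_powR' x : _ -> R).
Proof.
move=> a0; apply: subspace_continuous_measurable_fun => //.
exact: continuous_ratio_powR'.
Qed.

Lemma integral_ratio_powR' (x a b : R) : 0 < x -> 0 < a -> a < b ->
  (\int[mu]_(t in `[a, b]) (ratio_powR' x t)%:E <= 1)%E.
Proof.
move=> x0 a0 ab.
rewrite (@continuous_FTC2 R _ (ratio_powR x)) //.
- have /andP[_ b1] := ratio_powR_bounds x0 (lt_trans a0 ab).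
  have /andP[a1 _] := ratio_powR_bounds x0 a0.
  by rewrite -EFinB lee_fin lerBlDr (le_trans b1) // lerDl.
- exact: continuous_ratio_powR'.
- split.
  + move=> t; rewrite in_itv /= => /andP[ta _].
    exact/derivable_ratio_powR/(lt_trans a0).
  + exact/cvg_at_right_filter/continuous_ratio_powR.
  + exact/cvg_at_left_filter/continuous_ratio_powR/(lt_trans a0).
- move=> t; rewrite in_itv /= => /andP[ta _].
  rewrite derive1E; have := is_derive_ratio_powR x (lt_trans a0 ta).
  by move=> d; rewrite derive_val.
Qed.

Lemma integral_Gamma_integrand_le (x : R) : 0 < x ->
  (\int[mu]_(t in `]0%R, +oo[) (Gamma_integrand x t)%:E <=
   ((x + 1) `^ (x + 1) / x)%:E)%E.
Proof.
move=> x0; set C := _ / x.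
have C0 : 0 <= C by rewrite divr_ge0 ?powR_ge0 ?ltW.
pose I k := [set` `[k.+1%:R^-1, k.+2%:R : R]].
have I0 k : 0 < k.+1%:R^-1 :> R by rewrite invr_gt0.
have Ilt k : k.+1%:R^-1 < k.+2%:R :> R.
  by rewrite (@le_lt_trans _ _ 1) ?invf_le1 ?ler1n ?ltr1n.
have Iub : \bigcup_k I k = `]0, +oo[%classic.
  apply/seteqP; split=> t /=.
    by case=> k _; rewrite /I /= !in_itv /= andbT => /andP[/(lt_le_trans (I0 k))].
  rewrite in_itv /= andbT => t0.
  have tV0 : 0 <= t^-1 by rewrite invr_ge0 ltW.
  exists (Num.truncn (t^-1 + t)) => //; rewrite /I /= in_itv /=.
  set k := Num.truncn _.
  have := truncnS_gt (t^-1 + t); rewrite -/k => kt.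
  apply/andP; split; last by rewrite ltW // -natr1; lra.
  by rewrite -[leRHS]invrK lef_pV2 ?posrE ?invr_gt0 // ltW //; lra.
have Icvg : (\int[mu]_(t in I k) (Gamma_integrand x t)%:E)%E @[k --> \oo]
    --> (\int[mu]_(t in `]0%R, +oo[) (Gamma_integrand x t)%:E)%E.
  rewrite -Iub; apply: ge0_nondecreasing_set_cvg_integral.
  - move=> i k ik; apply/subsetPset => t; rewrite /I /= !in_itv /= => /andP[a b].
    apply/andP; split; first by apply: le_trans a; rewrite lef_pV2 ?posrE // ler_nat ltnS.
    by apply: le_trans b _; rewrite ler_nat !ltnS.
  - by move=> k; exact: measurable_itv.
  - by move=> k; apply/measurable_EFinP; exact: measurable_Gamma_integrand.
  - by move=> k t _; rewrite lee_fin Gamma_integrand_ge0.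
rewrite -(cvg_lim _ Icvg) //; apply: lime_le; first exact: (cvgP _ Icvg).
apply: nearW => k.
apply: (@le_trans _ _ (\int[mu]_(t in I k) (C%:E * (ratio_powR' x t)%:E)))%E.
  apply: ge0_le_integral.
  - exact: measurable_itv.
  - by move=> t _; rewrite lee_fin Gamma_integrand_ge0.
  - by apply/measurable_EFinP; exact: measurable_Gamma_integrand.
  - apply: measurable_funeM; apply/measurable_EFinP.
    exact: measurable_ratio_powR'.
  - move=> t; rewrite /I /= in_itv /= => /andP[/(lt_le_trans (I0 k)) t0 _].
    by rewrite -EFinM lee_fin Gamma_integrand_le.
rewrite ge0_integralZl //.
- rewrite -[leRHS]mule1 lee_wpmul2l ?lee_fin // integral_ratio_powR' //.
- exact: measurable_itv.
- by apply/measurable_EFinP; exact: measurable_ratio_powR'.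
- move=> t _; rewrite lee_fin /ratio_powR' mulr_ge0 // ?invr_ge0 ?sqr_ge0 //.
  by rewrite mulr_ge0 ?powR_ge0 ?ltW.
Qed.

(** The real-valued integral is [0] when the integral is infinite, so positivity
    needs the upper bound as well as a lower bound on [1, 2]. *)
Lemma Gamma_gt0 (x : R) : 0 < x -> 0 < Gamma R x.
Proof.
move=> x0; rewrite /Gamma /Rintegral fine_gt0 //; apply/andP; split; last first.
  exact: le_lt_trans (integral_Gamma_integrand_le x0) (ltry _).
apply: (@lt_le_trans _ _ (\int[mu]_(t in `[1%R, 2%R]) (expR (- 2) / 2)%:E)%E).
  rewrite integral_cst //= lebesgue_measure_itv /= lte_fin ltr1n -EFinB -EFinM.
  by rewrite lte_fin !mulr_gt0 ?expR_gt0 ?invr_gt0 // subr_gt0 ltr1n.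
apply: (@le_trans _ _ (\int[mu]_(t in `[1%R, 2%R]) (Gamma_integrand x t)%:E)%E).
  apply: (@ge0_le_integral _ _ _ mu) => //.
  - by apply/measurable_EFinP; exact: measurable_Gamma_integrand.
  move=> t; rewrite /= in_itv /= => /andP[t1 t2].
  have t0 : 0 < t by rewrite (lt_le_trans ltr01).
  rewrite lee_fin /Gamma_integrand mulrC ler_pM ?expR_ge0 //.
    rewrite powRD ?(gt_eqF t0) ?implybT // powR_inv1 ?(ltW t0) //.
    rewrite -[2^-1]mul1r ler_pM //.
    - by rewrite -[leLHS](powRr0 t) ler_powR // ltW.
    - by rewrite lef_pV2 ?posrE.
  by rewrite ler_expR lerN2.
apply: ge0_subset_integral => //.
- by apply/measurable_EFinP; exact: measurable_Gamma_integrand.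
- by move=> t _; rewrite lee_fin Gamma_integrand_ge0.
- by move=> t; rewrite /= !in_itv /= andbT => /andP[/(lt_le_trans ltr01)].
Qed.
Lemma omega_gt0 (m : nat) : (0 < m)%N -> 0 < omega R m.
Proof.
move=> m0; rewrite divr_gt0 ?mulr_gt0 ?powR_gt0 ?pi_gt0 //.
by rewrite Gamma_gt0 // divr_gt0 ?ltr0n.
Qed.

Lemma kappa_gt0 (m : nat) : 0 < kappa R m.
Proof.
rewrite divr_gt0 ?powR_gt0 ?pi_gt0 //.
by rewrite Gamma_gt0 // ltr_wpDl // divr_ge0 ?ler0n.
Qed.

Lemma coef_gt0 (n j r s l : nat) : (j < n)%N -> 0 < @coef R n j r s l.
Proof.
move=> jn; have fact_gt0 : 0 < (r`! * s`!)%:R^-1 :> R.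
  by rewrite invr_gt0 ltr0n muln_gt0 !fact_gt0.
rewrite /coef; case: eqP => [j0|/eqP j0].
  case: ifP => // _; apply: mulr_gt0 => //.
  by apply: divr_gt0; apply: omega_gt0; lia.
have og m : (0 < m)%N -> 0 < omega R m by exact: omega_gt0.
apply: mulr_gt0; first apply: mulr_gt0 => //.
  by apply: divr_gt0; apply: og; lia.
by apply: divr_gt0; apply: og; lia.
Qed.

End gamma_function.

(** * Hausdorff measures are measures on the Borel sets *)

Section euclidean_norm.
Context {R : realType} {n : nat}.
Local Notation E := 'rV[R]_n.
Implicit Types (x y : E) (A : set E).

Lemma dotvv_ge0 x : 0 <= dotv x x.
Proof. by apply: sumr_ge0 => i _; rewrite -expr2 sqr_ge0. Qed.

Lemma enorm_ge0 x : 0 <= enorm x.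
Proof. exact: sqrtr_ge0. Qed.

Lemma sqr_enorm x : enorm x ^+ 2 = dotv x x.
Proof. by rewrite sqr_sqrtr // dotvv_ge0. Qed.

Lemma coord_le_enorm x i : `|x 0 i| <= enorm x.
Proof.
rewrite -sqrtr_sqr ler_sqrt ?dotvv_ge0 // /dotv (bigD1 i) //= -expr2 lerDl.
by apply: sumr_ge0 => k _; rewrite -expr2 sqr_ge0.
Qed.

Lemma enorm_le_sum x : enorm x <= \sum_i `|x 0 i|.
Proof.
rewrite -(ler_pXn2r (n := 2)) ?nnegrE ?enorm_ge0 ?sumr_ge0 //.
rewrite sqr_enorm expr2 mulr_suml; apply: ler_sum => i _.
rewrite -expr2 -real_normK ?num_real // expr2 ler_wpM2l //.
by rewrite (bigD1 i) //= lerDl sumr_ge0.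
Qed.

Lemma coord_le_norm x i : `|x 0 i| <= `|x|.
Proof.
rewrite [leRHS]/Num.norm /= mx_normrE.
exact: (le_bigmax _ (fun ij => `|x ij.1 ij.2|) (0, i)).
Qed.

Lemma norm_le x r : 0 <= r -> (forall i, `|x 0 i| <= r) -> `|x| <= r.
Proof.
move=> r0 xr; rewrite [leLHS]/Num.norm /= mx_normrE.
by apply/bigmax_leP; split=> // -[i j] _ /=; rewrite (ord1 i).
Qed.

Lemma norm_le_enorm x : `|x| <= enorm x.
Proof. by apply: norm_le => [|i]; [exact: enorm_ge0|exact: coord_le_enorm]. Qed.

Lemma le_ediam A x y : A x -> A y -> ((enorm (x - y))%:E <= ediam A)%E.
Proof. by move=> Ax Ay; apply: ereal_sup_ubound; exists (x, y). Qed.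

Lemma ediam_le A (d : \bar R) :
  (forall x y, A x -> A y -> ((enorm (x - y))%:E <= d)%E) -> (ediam A <= d)%E.
Proof. by move=> Ad; apply: ge_ereal_sup => _ [[x y] [Ax Ay] <-]; exact: Ad. Qed.

Lemma ediam_set0 : ediam (set0 : set E) = -oo%E.
Proof. by apply/eqP; rewrite -leeNy_eq; exact: ediam_le. Qed.

Lemma ediam_ge0 A : A !=set0 -> (0 <= ediam A)%E.
Proof.
by move=> [x Ax]; apply: le_trans (le_ediam Ax Ax); rewrite lee_fin enorm_ge0.
Qed.

End euclidean_norm.

Section hausdorff_outer_measure.
Context {R : realType} {n : nat}.
Local Notation E := 'rV[R]_n.
Local Open Scope ereal_scope.
Implicit Types (A B : set E) (j : nat) (delta : R).

Lemma hausdorff_gauge_ge0 j A : 0 <= hausdorff_gauge j A.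
Proof.
rewrite /hausdorff_gauge; case: eqVneq => // /set0P /ediam_ge0 d0.
rewrite lee_fin; apply: mulr_ge0; first exact/ltW/kappa_gt0.
by rewrite exprn_ge0 ?divr_ge0 ?fine_ge0.
Qed.

Lemma hausdorff_gauge0 j : hausdorff_gauge j (set0 : set E) = 0.
Proof. by rewrite /hausdorff_gauge eqxx. Qed.

(** With an infinite gauge on the sets of diameter larger than [delta], covers by
    arbitrary sets take the place of covers by small ones.  The premeasure of
    size [delta] is then the outer measure generated by a gauge on the discrete
    sigma-algebra, and countable subadditivity is inherited. *)
Definition small_gauge j delta A : \bar R :=
  if ediam A <= delta%:E then hausdorff_gauge j A else +oo.

Lemma small_gauge_ge0 j delta A : 0 <= small_gauge j delta A.
Proof. by rewrite /small_gauge; case: ifP => // _; exact: hausdorff_gauge_ge0. Qed.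

Lemma small_gauge0 j delta : small_gauge j delta set0 = 0.
Proof. by rewrite /small_gauge ediam_set0 leNye hausdorff_gauge0. Qed.

Let allE : Type := g_sigma_algebraType [set: set E].

Lemma hausdorff_preE j delta : hausdorff_pre j delta =
  mu_ext (small_gauge j delta : set allE -> \bar R).
Proof.
apply/funext => A; apply/eqP; rewrite eq_le; apply/andP; split.
  apply: le_ereal_inf_tmp => _ [C [_ AC] <-].
  have [Cd|] := pselect (forall k, ediam (C k) <= delta%:E).
    apply: ereal_inf_lbound; exists C => //.
    by apply: eq_eseriesr => k _; rewrite /small_gauge Cd.
  move/existsNP => [k /negP Ck].
  have Sk : small_gauge j delta (C k) = +oo by rewrite /small_gauge (negbTE Ck).
  rewrite (eseries_pinfty _ _ Sk) ?leey // => i _.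
  by rewrite -ltNye (lt_le_trans _ (small_gauge_ge0 _ _ _)).
apply: le_ereal_inf_tmp => _ [C [AC Cd] <-].
apply: ereal_inf_lbound; exists C.
  by split=> // k; apply: sub_sigma_algebra.
by apply: eq_eseriesr => k _; rewrite /small_gauge Cd.
Qed.

Lemma hausdorff_pre_ge0 j delta A : 0 <= hausdorff_pre j delta A.
Proof. by rewrite hausdorff_preE mu_ext_ge0 //; exact: small_gauge_ge0. Qed.

Lemma hausdorff_pre_le j delta A :
  (0 < delta)%R -> hausdorff_pre j delta A <= hausdorff j A.
Proof. by move=> d0; apply: ereal_sup_ubound; exists delta. Qed.

Lemma hausdorff0 j : hausdorff j (set0 : set (borelE R n)) = 0.
Proof.
apply/eqP; rewrite eq_le; apply/andP; split.
  apply: ge_ereal_sup => _ [d d0 <-].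
  by rewrite hausdorff_preE mu_ext0 //; [exact: small_gauge0|exact: small_gauge_ge0].
exact: le_trans (hausdorff_pre_ge0 _ _ _) (hausdorff_pre_le _ _ ltr01).
Qed.

Lemma hausdorff_ge0 j (A : set (borelE R n)) : 0 <= hausdorff j A.
Proof. exact: le_trans (hausdorff_pre_ge0 _ _ _) (hausdorff_pre_le _ _ ltr01). Qed.

Lemma le_hausdorff j :
  {homo @hausdorff R n j : A B / A `<=` B >-> A <= B}.
Proof.
move=> A B AB; apply: ge_ereal_sup => _ [d d0 <-].
apply: le_trans (hausdorff_pre_le j B d0); rewrite hausdorff_preE.
exact: le_mu_ext.
Qed.

Lemma hausdorff_sigma_subadditive j : sigma_subadditive (@hausdorff R n j).
Proof.
move=> A; apply: ge_ereal_sup => _ [d d0 <-]; rewrite hausdorff_preE.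
have sub := @mu_ext_sigma_subadditive _ allE R (small_gauge j d)
  (small_gauge_ge0 j d) A.
apply: (le_trans sub).
apply: lee_nneseries => k _; rewrite -hausdorff_preE ?hausdorff_pre_ge0 //.
exact: hausdorff_pre_le.
Qed.

HB.instance Definition _ j := isOuterMeasure.Build R (borelE R n) (@hausdorff R n j)
  (hausdorff0 j) (hausdorff_ge0 j) (@le_hausdorff j)
  (hausdorff_sigma_subadditive j).
End hausdorff_outer_measure.

Section metric_outer_measure.
Context {R : realType} {V : normedModType R}.
Variable mu : {outer_measure set V -> \bar R}.
Local Open Scope ereal_scope.

Hypothesis mu_separated : forall (r : R) (A B : set V), (0 < r)%R ->
  (forall x y, A x -> B y -> (r <= `|x - y|)%R) -> mu A + mu B <= mu (A `|` B).

Section layers.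
Variables F X : set V.

Definition far (k : nat) : set V :=
  [set x | X x /\ forall y, F y -> (1 <= k%:R * `|x - y|)%R].

Definition layer k : set V := far k.+1 `\` far k.

Lemma far_sub k : far k `<=` X. Proof. by move=> x []. Qed.

Lemma far_nondecreasing i k : (i <= k)%N -> far i `<=` far k.
Proof.
move=> ik x [Xx xF]; split=> // y /xF /le_trans -> //.
by rewrite ler_wpM2r // ler_nat.
Qed.

(** A point of the layer is closer than [1 / k.+1] to [F], a point of [far k] is
    at distance at least [1 / k]; the triangle inequality leaves
    [1 / k - 1 / k.+1], of which the bound below is a lower estimate. *)
Lemma far_layer_separated k x z : far k x -> layer k.+1 z ->
  (k.+1%:R^-1 / k.+2%:R <= `|x - z| :> R)%R.
Proof.
case=> _ xF [[Xz _] zF].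
have [y Fy yz] : exists2 y, F y & (k.+1%:R * `|z - y| < 1)%R.
  apply: contrapT => /forall2NP nF; apply: zF; split=> // y Fy.
  by have [//|/negP] := nF y; rewrite -leNgt.
have {xF} := xF y Fy; have := ler_distD z x y.
move: (`|x - y|)%R (`|x - z|)%R (`|z - y|)%R (normr_ge0 (x - z)%R) yz => a c b c0.
rewrite ler_pdivrMr // -!natr1.
rewrite -div1r ler_pdivrMr ?ltr_wpDl //.
have : (0 <= k%:R :> R)%R by []. move: (k%:R)%R => K K0 b1 acb aK.
have h1 : (K * a <= K * (c + b))%R by rewrite ler_wpM2l.
have h2 : (K * ((K + 1) * b) <= K)%R by nra.
nra.
Qed.

Lemma mu_alternate_layers b N :
  \sum_(0 <= i < N.+1) mu (layer (i.*2 + b)) <= mu (far (N.*2 + b).+1).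
Proof.
elim: N => [|N IHN].
  by rewrite big_nat1; apply: le_outer_measure => x [].
rewrite big_nat_recr //=; apply: le_trans (leeD2r _ IHN) _ => //.
apply: le_trans (mu_separated (r := (N.*2 + b).+2%:R^-1 / (N.*2 + b).+3%:R) _ _) _.
- by rewrite divr_gt0.
- by move=> x z; rewrite doubleS addSn; exact: far_layer_separated.
- rewrite doubleS addSn; apply: le_outer_measure => x [|[]//].
  by apply: far_nondecreasing; lia.
Qed.

(** The layers of even index and those of odd index are summed separately. *)
Lemma mu_layers_le N :
  \sum_(0 <= i < N) mu (layer i) <= mu X + mu X.
Proof.
have le1 b : \sum_(0 <= i < N.+1) mu (layer (i.*2 + b)) <= mu X.
  apply: le_trans (mu_alternate_layers b N) _.
  exact/le_outer_measure/far_sub.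
apply: le_trans (leeD (le1 0%N) (le1 1%N)); rewrite -big_split /=.
have -> : \sum_(0 <= i < N.+1) (mu (layer (i.*2 + 0)) + mu (layer (i.*2 + 1))) =
    \sum_(0 <= i < N.+1.*2) mu (layer i).
  elim: N.+1 => [|m IHm]; first by rewrite !big_nil.
  by rewrite doubleS !big_nat_recr //= IHm addn0 addn1 addeA.
rewrite [leRHS](big_cat_nat (n := N)) //=; last by lia.
by rewrite leeDl // sume_ge0.
Qed.

Lemma off_closed_sub k : closed F ->
  X `&` ~` F `<=`
    far k `|` \bigcup_i (if (k <= i)%N then layer i else set0).
Proof.
move=> Fcl x [Xx nFx].
have [m far_m] : exists m, far m x.
  have : nbhs x (~` F) by apply: open_nbhs_nbhs; split=> //; exact: closed_openC.
  rewrite -nbhs_ballE => -[e /= e0 eF]; exists (Num.truncn e^-1).+1; split=> // y Fy.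
  have : ~ ball x e y by move=> /eF.
  rewrite -ball_normE /= => /negP; rewrite -leNgt => ey.
  apply: le_trans (ler_wpM2l _ ey) => //.
  by rewrite -ler_pdivrMr // div1r ltW // truncnS_gt.
have exm : exists m, `[< far m x >] by exists m; exact/asboolP.
case: (ex_minnP exm) => i /asboolP far_i min_i {m far_m exm}.
have [ik|ki] := leqP i k; first by left; exact: far_nondecreasing far_i.
have [m im] : exists m, i = m.+1 by exists i.-1; lia.
right; exists m => //; rewrite (_ : (k <= m)%N) ?im; last by lia.
split; first by rewrite -im.
by move=> /asboolP /min_i; lia.
Qed.

End layers.

(** The part of a test set [X] off a closed set [F] is exhausted by the points at
    distance at least [1 / k] from [F].  The layers added from one [k] to the next
    have summable measures, because every other layer is at positive distance from
    the preceding ones; hence the measures of the exhausting sets tend to that of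
    [X `&` ~` F]. *)
Lemma closed_caratheodory (F : set V) : closed F -> mu.-caratheodory F.
Proof.
move=> Fcl; apply: le_caratheodory_measurable => X.
have [->|Xfin] := eqVneq (mu X) +oo; first by rewrite leey.
pose tail k := \sum_(k <= i <oo) mu (layer F X i).
have sum_lty : \sum_(0 <= i <oo) mu (layer F X i) < +oo.
  apply: (@le_lt_trans _ _ (mu X + mu X)).
    apply: lime_le; first by apply: is_cvg_nneseries.
    by apply: nearW => N; exact: mu_layers_le.
  by rewrite lte_add_pinfty // ltey.
have le_tail k : mu (X `&` F) + mu (X `&` ~` F) <= mu X + tail k.
  have offle : mu (X `&` ~` F) <= mu (far F X k) + tail k.
    have sub := le_outer_measure mu _ _ (@off_closed_sub F X k Fcl).
    apply: (le_trans sub).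
    apply: (le_trans (outer_measureU2 mu _ _)); rewrite leeD2l //.
    apply: le_trans (outer_measure_sigma_subadditive mu
      (fun i => if (k <= i)%N then layer F X i else set0)) _.
    rewrite /tail [leRHS]eseries_cond eseries_mkcondr; apply: lee_nneseries => //= i _.
    by case: ifP => // _; rewrite outer_measure0.
  apply: le_trans (leeD2l _ offle) _; rewrite addeA leeD2r //.
  apply: le_trans (mu_separated (r := k.+1%:R^-1) _ _) _.
  - by rewrite invr_gt0.
  - move=> x y [_ Fx] [_ /(_ _ Fx)]; rewrite distrC => xy.
    rewrite -div1r ler_pdivrMr // mulrC (le_trans xy) // ler_wpM2r //.
    by rewrite ler_nat.
  - by apply: le_outer_measure => x [[]//|[]].
have tail0 : tail k @[k --> \oo] --> 0 by exact: nneseries_tail_cvg.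
apply/lee_addgt0Pr => e e0.
have /fine_cvgP[tail_fin /cvgrPdist_le /(_ e e0) tail_le] := tail0.
have [k _ tailk] : \forall k \near \oo, tail k <= e%:E.
  near=> k; have fk : tail k \is a fin_num by near: k.
  rewrite -(fineK fk) lee_fin.
  have : (`|0 - fine (tail k)| <= e)%R by near: k.
  by rewrite sub0r normrN ler_norml => /andP[].
by apply: le_trans (le_tail k) _; rewrite leeD2l //; apply: tailk => /=.
Unshelve. all: by end_near. Qed.

End metric_outer_measure.

Section hausdorff_measure.
Context {R : realType} {n : nat}.
Local Notation E := 'rV[R]_n.
Local Open Scope ereal_scope.
Implicit Types (A B : set E) (j : nat) (delta : R).

Lemma le_hausdorff_pre j delta delta' A : (delta' <= delta)%R ->
  hausdorff_pre j delta A <= hausdorff_pre j delta' A.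
Proof.
move=> dd; apply: ereal_inf_le_tmp => _ [C [AC Cd] <-].
by exists C => //; split=> // k; apply: le_trans (Cd k) _; rewrite lee_fin.
Qed.

(** A set of diameter less than [r] cannot meet both [A] and [B], so a cover of
    the union splits into disjoint covers of [A] and of [B]. *)
Lemma hausdorff_pre_separated j (r delta : R) A B : (delta < r)%R ->
  (forall x y, A x -> B y -> (r <= `|x - y|)%R) ->
  hausdorff_pre j delta A + hausdorff_pre j delta B <=
  hausdorff_pre j delta (A `|` B).
Proof.
move=> dr sep; apply: le_ereal_inf_tmp => _ [C [ABC Cd] <-].
pose meeting D k : set E := if `[< C k `&` D !=set0 >] then C k else set0.
have pre_le D : D `<=` A `|` B ->
    hausdorff_pre j delta D <= \sum_(k <oo) hausdorff_gauge j (meeting D k).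
  move=> DAB; apply: ereal_inf_lbound; exists (meeting D) => //; split.
    move=> x Dx; have [k _ Ckx] := ABC x (DAB x Dx).
    by exists k => //; rewrite /meeting asboolT //; exists x.
  by move=> k; rewrite /meeting; case: ifP => // _; rewrite ediam_set0 leNye.
have := leeD (pre_le A (@subsetUl _ _ _)) (pre_le B (@subsetUr _ _ _)).
move=> /le_trans; apply; rewrite -nneseriesD; last 2 first.
- by move=> k _ _; exact: hausdorff_gauge_ge0.
- by move=> k _ _; exact: hausdorff_gauge_ge0.
apply: lee_nneseries => k _.
  by rewrite adde_ge0 // hausdorff_gauge_ge0.
rewrite /meeting; case: asboolP => [[x [Ckx Ax]]|_]; last first.
  rewrite hausdorff_gauge0 add0e; case: ifP => // _.
  by rewrite ?hausdorff_gauge0 ?hausdorff_gauge_ge0.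
rewrite asboolF ?hausdorff_gauge0 ?adde0 // => -[y [Cky By]].
have := le_trans (le_ediam Ckx Cky) (Cd k); rewrite lee_fin.
move=> /(le_trans (norm_le_enorm _)) /(le_trans (sep _ _ Ax By)).
by rewrite leNgt dr.
Qed.

Lemma hausdorff_separated j (r : R) (A B : set (borelE R n)) : (0 < r)%R ->
  (forall x y : E, A x -> B y -> (r <= `|x - y|)%R) ->
  hausdorff j A + hausdorff j B <= hausdorff j (A `|` B).
Proof.
move=> r0 sep.
have pre_le (d1 d2 : R) : (0 < d1)%R -> (0 < d2)%R ->
    hausdorff_pre j d1 A + hausdorff_pre j d2 B <= hausdorff j (A `|` B).
  move=> d10 d20; pose d := Num.min (Num.min d1 d2) (r / 2)%R.
  have d0 : (0 < d)%R by rewrite !lt_min d10 d20 divr_gt0.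
  apply: le_trans (hausdorff_pre_le _ _ d0).
  have dr : (d < r)%R.
    by rewrite (@le_lt_trans _ _ (r / 2)%R) ?ge_min ?lexx ?orbT //; lra.
  apply: le_trans (hausdorff_pre_separated _ dr sep).
  by apply: leeD; apply: le_hausdorff_pre; rewrite !ge_min lexx ?orbT.
have [->|] := eqVneq (hausdorff j (A `|` B)) +oo; first by rewrite leey.
move=> ABoo; have fin (x : \bar R) : 0 <= x -> x <= hausdorff j (A `|` B) ->
    x \is a fin_num.
  by move=> x0 xAB; rewrite ge0_fin_numE // (le_lt_trans xAB) // ltey.
have finpre d : (0 < d)%R -> hausdorff_pre j d B \is a fin_num.
  move=> d0; apply: fin (hausdorff_pre_ge0 _ _ _) _.
  by apply: le_trans (hausdorff_pre_le _ _ d0) (le_hausdorff _ (@subsetUr _ _ _)).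
have finA : hausdorff j A \is a fin_num.
  exact: fin (hausdorff_ge0 _ _) (le_hausdorff _ (@subsetUl _ _ _)).
rewrite addeC -leeBrDr //; apply: ge_ereal_sup => _ [d2 d20 <-].
rewrite leeBrDr // addeC -leeBrDr ?finpre //.
by apply: ge_ereal_sup => _ [d1 d10 <-]; rewrite leeBrDr ?finpre // pre_le.
Qed.

(** Caratheodory measurable sets form a sigma-algebra, which contains the closed
    sets because Hausdorff measure is additive on separated sets. *)
Lemma borel_caratheodory j (A : set (borelE R n)) :
  measurable A -> (@hausdorff R n j).-caratheodory A.
Proof.
have closedP (F : set E) : closed F -> (@hausdorff R n j).-caratheodory F.
  exact: (@closed_caratheodory R E
    (@hausdorff R n j : {outer_measure set _ -> \bar R})
    (@hausdorff_separated j)).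
pose H : {outer_measure set (borelE R n) -> \bar R} := @hausdorff R n j.
apply: (@smallest_sub _ _ _ H.-caratheodory); last first.
  move=> O openO; rewrite -(setCK O); apply: (@caratheodory_measurable_setC _ _ H).
  by apply: closedP; exact: open_closedC.
split.
- exact: (caratheodory_measurable_set0 H).
- by move=> B; rewrite setTD; exact: (@caratheodory_measurable_setC _ _ H).
- exact: (@caratheodory_measurable_bigcup _ _ H).
Qed.

Lemma hausdorff_sigma_additive j :
  semi_sigma_additive (@hausdorff R n j).
Proof.
move=> A mA tA mU.
exact: (@caratheodory_measure_sigma_additive R (borelE R n)
  (@hausdorff R n j : {outer_measure set _ -> \bar R}) A
  (fun i => borel_caratheodory j (mA i)) tA (borel_caratheodory j mU)).
Qed.

HB.instance Definition _ j := isMeasure.Build _ (borelE R n) R (@hausdorff R n j)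
  (hausdorff0 j) (hausdorff_ge0 j) (@hausdorff_sigma_additive j).

End hausdorff_measure.

(** * Finiteness and positivity of Hausdorff measures *)

Section hausdorff_bounds.
Context {R : realType} {n : nat}.
Local Notation E := 'rV[R]_n.
Implicit Types (A B : set E).

Lemma hausdorff_pre_le_fin (k : nat) (d : R) (T : finType) (D : T -> set E) A :
  A `<=` \bigcup_t D t -> (forall t, (ediam (D t) <= d%:E)%E) ->
  (hausdorff_pre k d A <= \sum_t hausdorff_gauge k (D t))%E.
Proof.
move=> AD Dd; pose s := [seq D t | t <- enum T]; pose C m := nth set0 s m.
have sD m : C m = set0 \/ exists t, C m = D t.
  have [ms|ms] := ltnP m (size s); last by left; rewrite /C nth_default.
  right; have [t _ tm] : exists2 t, t \in enum T & nth set0 s m = D t.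
    by apply/mapP; exact: mem_nth.
  by exists t.
have -> : (\sum_t hausdorff_gauge k (D t) = \sum_(m <oo) hausdorff_gauge k (C m))%E.
  rewrite (nneseries_split 0%N (size s)); last by move=> *; exact: hausdorff_gauge_ge0.
  rewrite add0n [X in (_ + X)%E]eseries0 ?adde0.
    by rewrite -(big_nth set0 xpredT (hausdorff_gauge k)) big_map big_enum.
  by move=> m sm _; rewrite /C nth_default // hausdorff_gauge0.
apply: ereal_inf_lbound; exists C => //; split.
  move=> x /AD[t _ Dtx]; exists (seq.index t (enum T)) => //.
  rewrite /C /s (nth_map t) ?index_mem ?mem_enum //.
  by rewrite nth_index ?mem_enum.
by move=> m; case: (sD m) => [->|[t ->] //]; rewrite ediam_set0 leNye.
Qed.

Lemma hausdorff_gauge_le k (A : set E) (d : R) : 0 <= d -> (ediam A <= d%:E)%E ->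
  (hausdorff_gauge k A <= (kappa R k * (d / 2) ^+ k)%:E)%E.
Proof.
move=> d0 Ad; have ? := ltW (@kappa_gt0 R k).
have [->|/set0P A0] := eqVneq A set0.
  by rewrite hausdorff_gauge0 lee_fin mulr_ge0 // exprn_ge0 // divr_ge0.
rewrite /hausdorff_gauge; case: ifP => // _.
  by rewrite lee_fin mulr_ge0 // exprn_ge0 // divr_ge0.
have dA0 := ediam_ge0 A0.
rewrite lee_fin ler_wpM2l // lerXn2r ?nnegrE ?divr_ge0 ?fine_ge0 //.
rewrite ler_pM2r ?invr_gt0 // -lee_fin fineK // ge0_fin_numE //.
exact: le_lt_trans Ad (ltry _).
Qed.

(** When [k] coordinates control the distances inside [A], cutting the range of
    each of them into [N] intervals cuts [A] into [N ^ k] pieces of diameter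
    [O(1/N)]; the sum of the [k]-th powers of the diameters does not depend
    on [N]. *)
Lemma hausdorff_lty (k : nat) (iota : 'I_k -> 'I_n) (A : set E) (C w : R) :
  0 < C -> 0 < w -> (forall x, A x -> forall i, `|x 0 (iota i)| <= w) ->
  (forall x y M, A x -> A y -> 0 <= M ->
     (forall i, `|x 0 (iota i) - y 0 (iota i)| <= M) -> enorm (x - y) <= C * M) ->
  (hausdorff k (A : set (borelE R n)) < +oo)%E.
Proof.
move=> C0 w0 Aw AC.
apply: (@le_lt_trans _ _ (kappa R k * (C * w) ^+ k)%:E); last exact: ltry.
apply: ge_ereal_sup => _ [d d0 <-].
pose N' := Num.truncn (C * (2 * w) / d); pose N := N'.+1.
have NR : 0 < N%:R :> R by [].
have dN : C * (2 * w / N%:R) <= d.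
  have := truncnS_gt (C * (2 * w) / d); rewrite ltr_pdivrMr // => h.
  by rewrite mulrA ler_pdivrMr // (mulrC d) ltW.
pose D (q : {ffun 'I_k -> 'I_N}) : set E := [set x | A x /\ forall i,
  (q i)%:R <= (x 0 (iota i) + w) * N%:R / (2 * w) <= (q i)%:R + 1].
have diamD q : (ediam (D q) <= (C * (2 * w / N%:R))%:E)%E.
  apply: ediam_le => x y [Ax qx] [Ay qy]; rewrite lee_fin.
  apply: AC => // [|i]; first by rewrite divr_ge0 ?mulr_ge0 ?ltW.
  have := qx i; have := qy i; move: (x 0 _) (y 0 _) => a b.
  rewrite !ler_pdivlMr ?ler_pdivrMr ?mulr_gt0 // => /andP[b1 b2] /andP[a1 a2].
  rewrite -[X in _ * X](ger0_norm (ltW NR)) -normrM ler_norml.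
  by apply/andP; split; lra.
have cover : A `<=` \bigcup_q D q.
  move=> x Ax; pose t i := (x 0 (iota i) + w) * N%:R / (2 * w).
  exists [ffun i => inord (minn (Num.truncn (t i)) N')] => //; split=> // i.
  have /ler_normlP[wx xw] := Aw x Ax i.
  have t0 : 0 <= t i by rewrite divr_ge0 ?mulr_ge0 ?(ltW w0) //; lra.
  have tN : t i <= N%:R.
    by rewrite ler_pdivrMr ?mulr_gt0 // mulrC ler_wpM2l ?(ltW NR) //; lra.
  rewrite ffunE inordK ?ltnS ?geq_minr // -/(t i).
  have /andP[tl tr] := truncn_itv t0.
  rewrite /minn; case: ltnP => tN'; first by rewrite tl natr1 ltW.
  by rewrite natr1 tN andbT (le_trans _ tl) // ler_nat.
apply: le_trans (hausdorff_pre_le_fin _ cover _) _.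
  by move=> q; apply: le_trans (diamD q) _; rewrite lee_fin.
apply: (@le_trans _ _ (\sum_(q : {ffun 'I_k -> 'I_N})
    (kappa R k * (C * (2 * w / N%:R) / 2) ^+ k)%:E))%E.
  apply: lee_sum => q _; apply: hausdorff_gauge_le (diamD q).
  by rewrite mulr_ge0 ?divr_ge0 ?mulr_ge0 ?ltW.
rewrite sumEFin lee_fin sumr_const card_ffun !card_ord -[leLHS]mulr_natr natrX.
rewrite -(mulrA (kappa R k)) -exprMn [X in _ * X ^+ _ <= _](_ : _ = C * w) //.
by field; rewrite gt_eqF.
Qed.

(** Reducing every coordinate modulo [L.+1] is injective on [S]. *)
Lemma card_close_ffun (k N L : nat) (S : {set {ffun 'I_k -> 'I_N}}) :
  (forall q q', q \in S -> q' \in S -> forall i, (q i <= q' i + L)%N) ->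
  (#|S| <= L.+1 ^ k)%N.
Proof.
move=> SL; pose f (q : {ffun 'I_k -> 'I_N}) : {ffun 'I_k -> 'I_L.+1} :=
  [ffun i => inord (q i %% L.+1)].
have f_inj : {in S &, injective f}.
  move=> q q' qS q'S /ffunP ff; apply/ffunP => i; apply/val_inj => /=.
  have := congr1 val (ff i); rewrite !ffunE /= !inordK ?ltn_mod // => e.
  have := SL _ _ qS q'S i; have := SL _ _ q'S qS i.
  have := divn_eq (q i) L.+1; have := divn_eq (q' i) L.+1; rewrite e.
  move: (q i : nat) (q' i : nat) => a b.
  move: (_ %/ _)%N (_ %/ _)%N (_ %% _)%N => u v c -> ->.
  have [uv|uv|->//] := ltngtP u v.
    by have : (u.+1 * L.+1 <= v * L.+1)%N by [rewrite leq_mul]; rewrite mulSn; lia.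
  by have : (v.+1 * L.+1 <= u * L.+1)%N by [rewrite leq_mul]; rewrite mulSn; lia.
rewrite -(card_in_imset f_inj); apply: leq_trans (max_card _) _.
by rewrite card_ffun !card_ord.
Qed.

Lemma expr_add_small (d eta : R) (k : nat) : 0 < eta ->
  exists2 e, 0 < e & (d + 3 * e) ^+ k <= d ^+ k + eta.
Proof.
move=> eta0.
have c : (fun e : R => (d + 3 * e) ^+ k) @ 0 --> (d + 3 * 0) ^+ k.
  apply: (@continuous_comp _ _ _ (fun e : R => d + 3 * e) (fun x => x ^+ k)).
    by apply: cvgD; [exact: cvg_cst|apply: cvgM; [exact: cvg_cst|exact: cvg_id]].
  exact: exprn_continuous.
have /cvgrPdist_le /(_ _ eta0) := c; rewrite mulr0 addr0.
rewrite -nbhs_ballE => -[r /= r0 rP]; exists (r / 2); first by rewrite divr_gt0.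
have := rP (r / 2); rewrite -ball_normE /= sub0r normrN gtr0_norm ?divr_gt0 //.
by move=> /(_ _) /ler_normlP; rewrite ltr_pdivrMr //; case; lra.
Qed.

(** By compactness a cover of [A] may be replaced by finitely many slightly larger
    open sets.  A set
    of diameter [d] contains at most about [(N d / w) ^ k] of the [N ^ k] lattice
    points of the box onto which [A] projects, so the [k]-th powers of the
    diameters add up to at least [w ^ k]. *)
Lemma hausdorff_gt0 (k : nat) (iota : 'I_k -> 'I_n) (A : set E)
    (a : 'I_k -> R) (w : R) :
  0 < w -> compact A ->
  (forall z, (forall i, a i <= z i <= a i + w) ->
     exists2 x, A x & forall i, x 0 (iota i) = z i) ->
  (0 < hausdorff k (A : set (borelE R n)))%E.
Proof.
move=> w0 Acpt Abox.
have K0 := @kappa_gt0 R k.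
apply: (@lt_le_trans _ _ (kappa R k * (w / 2) ^+ k)%:E).
  by rewrite lte_fin mulr_gt0 // exprn_gt0 // divr_gt0.
apply: le_trans (hausdorff_pre_le k A ltr01).
apply: le_ereal_inf_tmp => _ [C [AC Cd] <-].
apply/lee_addgt0Pr => e e0.
(* The error [eta m] allowed in [d m ^ k] makes the total error on the gauges
   equal to [e], as [kappa / 2 ^ k * eta m = e / 2 ^ m.+1]. *)
pose eta (m : nat) : R := e * 2 ^+ k / kappa R k / (2 ^ m.+1)%:R.
have eta0 m : 0 < eta m.
  apply: divr_gt0; last by rewrite ltr0n expn_gt0.
  by apply: divr_gt0 => //; rewrite mulr_gt0 // exprn_gt0.
pose d m := fine (ediam (C m)).
have /choice [r rP] : forall m, exists r, 0 < r /\ (d m + 3 * r) ^+ k <= d m ^+ k + eta m.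
  by move=> m; have [r r0 rP] := expr_add_small (d m) k (eta0 m); exists r.
pose U m : set E := \bigcup_(c in C m) ball c (r m).
have Uopen m : open (U m) by apply: bigcup_open => c _; exact: ball_open.
have AU : A `<=` cover setT U.
  move=> x /AC[m _ Cx]; exists m => //; exists x => //.
  exact: ballxx (rP m).1.
move: Acpt; rewrite compact_cover => /(_ nat setT U (fun m _ => Uopen m) AU).
case=> D _ AD; pose M := \max_(m <- finmap.enum_fset D) m.+1.
have {}AD x : A x -> exists2 m, (m < M)%N & U m x.
  move=> /AD[m mD Umx]; exists m => //.
  exact: (@leq_bigmax_seq _ (finmap.enum_fset D) xpredT succn m).
(* Of the enlargement [3 * r m], two thirds account for the balls of radius [r m]
   around [C m]; the last third absorbs the mesh [w / N] of the lattice. *)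
pose N := (Num.truncn (\sum_(m < M) w / r m)).+1.
have NR : 0 < N%:R :> R by [].
have wN m : (m < M)%N -> w / N%:R <= r m.
  move=> mM; rewrite ler_pdivrMr // mulrC -ler_pdivrMr ?(rP m).1 //.
  apply/ltW/(le_lt_trans _ (truncnS_gt _)).
  rewrite (bigD1 (Ordinal mM)) //= lerDl sumr_ge0 // => i _.
  by rewrite divr_ge0 ?ltW // (rP i).1.
have /choice [X XP] : forall q : {ffun 'I_k -> 'I_N}, exists x, A x /\
    forall i, x 0 (iota i) = a i + w * (q i)%:R / N%:R.
  move=> q; have [|x Ax xi] := Abox (fun i => a i + w * (q i)%:R / N%:R); last by exists x.
  move=> i; rewrite lerDl divr_ge0 ?mulr_ge0 ?(ltW w0) //= lerD2l ler_pdivrMr //.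
  by rewrite ler_wpM2l ?(ltW w0) // ler_nat ltnW.
pose S m := [set q | `[< U m (X q) >]]%SET.
have cardS : (N ^ k <= \sum_(m < M) #|S m|)%N.
  rewrite -[X in (X ^ _)%N]card_ord -[X in (_ ^ X)%N]card_ord -card_ffun -sum1_card.
  apply: (@leq_trans (\sum_(q : {ffun 'I_k -> 'I_N}) \sum_(m < M) (q \in S m))).
    apply: leq_sum => q _; have [m mM Um] := AD _ (XP q).1.
    rewrite (bigD1 (Ordinal mM)) //= inE asboolT //.
  rewrite exchange_big /=; apply: leq_sum => m _.
  rewrite -sum1_card [leqRHS]big_mkcond; apply: leq_sum => q _.
  by case: (q \in S m).
have S_le (m : 'I_M) : (((#|S m|)%:R * (kappa R k * (w / 2) ^+ k / N%:R ^+ k))%:E <=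
    hausdorff_gauge k (C m) + (e / (2 ^ m.+1)%:R)%:E)%E.
  have [S0|[q0 q0S]] := set_0Vmem (S m).
    rewrite S0 cards0 mul0r adde_ge0 ?hausdorff_gauge_ge0 // lee_fin.
    by rewrite divr_ge0 // ltW.
  have Cm0 : C m !=set0.
    by move: q0S; rewrite !inE => -[c Cc _]; exists c.
  have dm0 := ediam_ge0 Cm0.
  have dmE : ediam (C m) = (d m)%:E.
    by rewrite fineK // ge0_fin_numE // (le_lt_trans (Cd m)) // ltry.
  have d0 : 0 <= d m by rewrite fine_ge0.
  have [rm0 rm_le] := rP m; have wNm := wN m (ltn_ord m).
  pose L := Num.truncn (N%:R * (d m + 2 * r m) / w).
  have L_itv : L%:R <= N%:R * (d m + 2 * r m) / w < L.+1%:R.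
    by apply: truncn_itv; rewrite divr_ge0 ?(ltW w0) // mulr_ge0 //; lra.
  have SL : (#|S m| <= L.+1 ^ k)%N.
    apply: card_close_ffun => q q'; rewrite !inE => -[c Cc cq] [c' Cc' c'q'] i.
    have coord (y z : E) s : ball y s z -> `|y 0 (iota i) - z 0 (iota i)| <= s.
      rewrite -ball_normE /= => /ltW /(le_trans (coord_le_norm _ (iota i))).
      by rewrite !mxE.
    have := coord _ _ _ cq; have := coord _ _ _ c'q'.
    have cc' : `|c 0 (iota i) - c' 0 (iota i)| <= d m.
      have := le_ediam Cc Cc'; rewrite dmE lee_fin; apply: le_trans.
      by have := coord_le_enorm (c - c') (iota i); rewrite !mxE.
    rewrite (XP q).2 (XP q').2; move: cc'.
    move: (c 0 (iota i)) (c' 0 (iota i)) => u v.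
    rewrite !ler_norml => /andP[_ uv] /andP[_ v1] /andP[u1 _].
    have qq' : w * (q i)%:R / N%:R <= w * (q' i)%:R / N%:R + (d m + 2 * r m) by lra.
    rewrite -ltnS -addnS -(ltr_nat R) natrD.
    case/andP: L_itv => _; rewrite ltr_pdivrMr // => L2.
    move: qq'; rewrite ler_pdivrMr // mulrDl divfK ?gt_eqF // => qq'.
    rewrite -(ltr_pM2l w0) (le_lt_trans qq') // mulrDr ltrD2l.
    by rewrite mulrC (mulrC w).
  have L_le : L.+1%:R <= N%:R / w * (d m + 3 * r m).
    case/andP: L_itv => L1 _; rewrite -natr1; apply: (@le_trans _ _
      (N%:R * (d m + 2 * r m) / w + 1)); first by rewrite lerD2r.
    move: wNm; rewrite ler_pdivrMr // => wNm.
    rewrite -(ler_pM2r w0) mulrDl divfK ?gt_eqF // mulrAC divfK ?gt_eqF //.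
    by nra.
  have -> : hausdorff_gauge k (C m) = (kappa R k * (d m / 2) ^+ k)%:E.
    rewrite /hausdorff_gauge; case: ifP => // /eqP C0.
    by case: Cm0 => c; rewrite C0.
  rewrite -EFinD lee_fin.
  apply: (@le_trans _ _ ((N%:R / w * (d m + 3 * r m)) ^+ k *
      (kappa R k * (w / 2) ^+ k / N%:R ^+ k))).
    apply: ler_wpM2r.
      by rewrite divr_ge0 ?exprn_ge0 // mulr_ge0 ?(ltW K0) // exprn_ge0 // divr_ge0 // ltW.
    apply: (@le_trans _ _ ((L.+1 ^ k)%N%:R)); first by rewrite ler_nat.
    by rewrite natrX lerXn2r ?nnegrE // (le_trans _ L_le).
  have -> : (N%:R / w * (d m + 3 * r m)) ^+ k * (kappa R k * (w / 2) ^+ k / N%:R ^+ k)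
      = (d m + 3 * r m) ^+ k * (kappa R k / 2 ^+ k).
    rewrite !exprMn !exprVn; field.
    by rewrite !expf_neq0 // gt_eqF.
  apply: le_trans (ler_wpM2r _ rm_le) _.
    by rewrite divr_ge0 ?exprn_ge0 // ltW.
  rewrite mulrDl /eta exprMn exprVn le_eqVlt; apply/orP; left; apply/eqP; field.
  by rewrite pnatr_eq0 expn_eq0 /= expf_neq0 //= gt_eqF.
apply: (@le_trans _ _ (\sum_(m < M) (hausdorff_gauge k (C m) +
    (e / (2 ^ m.+1)%:R)%:E))%E).
  apply: le_trans (lee_sum _ (fun m _ => S_le m)).
  rewrite sumEFin lee_fin -mulr_suml -natr_sum.
  rewrite mulrA ler_pdivlMr ?exprn_gt0 // mulrC ler_pM2r; last first.
    by rewrite mulr_gt0 // exprn_gt0 // divr_gt0.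
  by rewrite -natrX ler_nat.
apply: le_trans (epsilon_trick xpredT _ (ltW e0)); last first.
  by move=> m; exact: hausdorff_gauge_ge0.
rewrite -(big_mkord xpredT (fun m => hausdorff_gauge k (C m) + (e / (2 ^ m.+1)%:R)%:E)%E).
apply: nneseries_lim_ge => m _ _.
by rewrite adde_ge0 ?hausdorff_gauge_ge0 // lee_fin divr_ge0 ?ltW.
Qed.

End hausdorff_bounds.

(** * Averages over shrinking sets *)

Section averages.
Context {d} {T : measurableType d} {R : realType}.
Variable mu : {measure set T -> \bar R}.

Lemma average_cvg (A : nat -> set T) (f : T -> R) (c : R) :
  (forall k, measurable (A k)) -> (forall k, 0 < mu (A k) < +oo)%E ->
  measurable_fun setT f ->
  (forall e, 0 < e -> \forall k \near \oo, forall x, A k x -> `|f x - c| <= e) ->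
  (\int[mu]_(x in A k) f x) / fine (mu (A k)) @[k --> \oo] --> c.
Proof.
move=> mA A_fin mf fc; apply/cvgrPdist_le => e e0.
near=> k; have fk : forall x, A k x -> `|f x - c| <= e by near: k; exact: fc.
have /andP[mu0 muoo] := A_fin k.
have muA : 0 < fine (mu (A k)) by rewrite fine_gt0 // mu0.
have cst_int r : mu.-integrable (A k) (EFin \o cst r).
  apply: measurable_bounded_integrable => //.
  by exists `|r|; split; [exact: num_real|move=> M rM x _; exact: ltW].
have f_int : mu.-integrable (A k) (EFin \o f).
  apply: measurable_bounded_integrable => //.
    exact: measurable_funS mf.
  exists (`|c| + e); split; first exact: num_real.
  move=> M cM x Ax /=; apply/ltW/(le_lt_trans _ cM).
  by rewrite -(subrK c (f x)) addrC (le_trans (ler_normD _ _)) // lerD2l fk.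
rewrite -normrN opprB ler_norml lerBrDr lerBlDr.
rewrite ler_pdivlMr // ler_pdivrMr //; apply/andP; split.
  rewrite -(Rintegral_cst mu (mA k)).
  apply: le_Rintegral => //; first exact: cst_int.
  by move=> x /fk; rewrite ler_norml => /andP[]; lra.
rewrite -(Rintegral_cst mu (mA k)).
apply: le_Rintegral => //; first exact: cst_int.
by move=> x /fk; rewrite ler_norml => /andP[]; lra.
Unshelve. all: by end_near. Qed.

(** This replaces differentiation of measures: the averages of a monomial over
    test sets shrinking to a point recover its value at that point. *)
Lemma average_pow_cvg (A : nat -> set T) (f : T -> R) (c : R) (s : nat) :
  (forall k, measurable (A k)) -> (forall k, 0 < mu (A k) < +oo)%E ->
  measurable_fun setT f ->
  (forall e, 0 < e -> \forall k \near \oo, forall x, A k x -> `|f x - c| <= e) ->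
  (\int[mu]_(x in A k) (f x ^+ s)) / fine (mu (A k)) @[k --> \oo] --> c ^+ s.
Proof.
move=> mA A_fin mf fc; apply: average_cvg => //; first exact: measurable_funX.
move=> e e0; have /cvgrPdist_le /(_ e e0) := @exprn_continuous R s c.
rewrite -nbhs_ballE => -[r /= r0 rP].
have r20 : 0 < r / 2 by rewrite divr_gt0.
near=> k => x Ax; rewrite distrC; apply: rP; rewrite -ball_normE /= distrC.
apply: (@le_lt_trans _ _ (r / 2)); last lra.
by move: x Ax; near: k; exact: fc.
Unshelve. all: by end_near. Qed.

End averages.

Section borel_dot.
Context {R : realType} {n : nat}.
Local Notation E := 'rV[R]_n.

Lemma closed_borel (A : set E) : closed A -> measurable (A : set (borelE R n)).
Proof.
move=> Acl; rewrite -(setCK A); apply: measurableC.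
by apply: sub_sigma_algebra; exact: closed_openC.
Qed.

Lemma continuous_dotv (f g : E -> E) : continuous f -> continuous g ->
  continuous (fun x : E => dotv (f x) (g x)).
Proof.
have coord (h : E -> E) i : continuous h -> continuous (fun x : E => h x 0 i : R).
  move=> ch x; apply: (@continuous_comp _ _ _ h (fun z : E => z 0 i) x (ch x)).
  exact: (@coord_continuous R 1 n 0 i).
move=> cf cg; apply: continuous_big => [|i _]; first exact: add_continuous.
by move=> x; apply: continuousM; apply: coord.
Qed.

Lemma measurable_dotv (y : E) :
  measurable_fun setT ((fun x : E => dotv x y) : borelE R n -> R).
Proof.
apply: (measurability _ (RGenOInfty.measurableE R)) => _ [_ [a ->] <-].
rewrite setTI; apply: sub_sigma_algebra.
apply: open_comp => [x _|]; last exact: rray_open.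
apply: (@continuous_dotv id (cst y)) => {}x; first by move=> P.
exact: cst_continuous.
Qed.

End borel_dot.

(** * Boxes in coordinate subspaces and caps of the unit sphere *)

Section test_sets.
Context {R : realType} {n : nat}.
Local Notation E := 'rV[R]_n.

Lemma closed_forall (T : topologicalType) (I : Type) (P : I -> set T) :
  (forall i, closed (P i)) -> closed [set x | forall i, P i x].
Proof.
move=> Pcl; rewrite (_ : mkset _ = \bigcap_i P i).
  exact: closed_bigI.
by apply/seteqP; split=> x Px i //; exact: Px.
Qed.

Lemma closed_imply (T : topologicalType) (b : bool) (P : set T) :
  closed P -> closed [set x | b -> P x].
Proof.
case: b => Pcl.
  by rewrite (_ : mkset _ = P) //; apply/seteqP; split=> x //= h; exact: h.
by rewrite (_ : mkset _ = setT) //; apply/seteqP; split.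
Qed.

Lemma closed_le_fun (f g : E -> R) : continuous f -> continuous g ->
  closed [set x | f x <= g x].
Proof.
move=> cf cg; rewrite (_ : mkset _ = (fun x => g x - f x) @^-1` [set t | 0 <= t]).
  apply: closed_comp => [x _|]; last exact: closed_ge.
  by apply: continuousB; [exact: cg | exact: cf].
by apply/seteqP; split=> x /=; rewrite subr_ge0.
Qed.

Lemma closed_eq_fun (f g : E -> R) : continuous f -> continuous g ->
  closed [set x | f x = g x].
Proof.
move=> cf cg; rewrite (_ : mkset _ = [set x | f x <= g x] `&` [set x | g x <= f x]).
  by apply: closedI; apply: closed_le_fun.
apply/seteqP; split=> x /= => [->|[fg gf]]; first by rewrite lexx.
by apply/eqP; rewrite eq_le fg gf.
Qed.

Lemma continuous_coord (i : 'I_n) : continuous (fun x : E => x 0 i : R).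
Proof. exact: coord_continuous. Qed.

Lemma continuous_norm_coord (f : E -> R) :
  continuous f -> continuous (fun x : E => `|f x|).
Proof. by move=> cf x; apply: continuous_comp; [exact: cf | exact: norm_continuous]. Qed.

Lemma compact_coord_bounded (A : set E) (M : R) :
  closed A -> (forall x, A x -> forall i, `|x 0 i| <= M) -> compact A.
Proof.
move=> Acl AM; apply: bounded_closed_compact => //.
exists `|M|; split; first exact: num_real.
move=> L ML x Ax; apply: norm_le; first by rewrite (le_trans (normr_ge0 M)) ?ltW.
by move=> i; rewrite (le_trans (AM x Ax i)) // (le_trans (ler_norm M)) ?ltW.
Qed.

Definition flat_box (j : nat) (x0 : E) (delta : R) : set E :=
  [set x | (forall i : 'I_n, (i < j)%N -> `|x 0 i - x0 0 i| <= delta) /\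
           (forall i : 'I_n, (j <= i)%N -> x 0 i = x0 0 i)].

(** A cone in the orthogonal complement of the first [j] axes, of full dimension
    there, that shrinks to the ray spanned by axis [j] as [eta] tends to [0]. *)
Definition narrow_cone (j : 'I_n) (eta : R) : set E :=
  [set u | [/\ forall i : 'I_n, (i < j)%N -> u 0 i = 0, 0 <= u 0 j &
    forall i : 'I_n, (j < i)%N -> `|u 0 i| <= eta * u 0 j]].

Lemma closed_flat_box j x0 delta : closed (flat_box j x0 delta).
Proof.
have cB i : continuous (fun x : E => x 0 i - x0 0 i).
  by move=> x; apply: continuousB; [exact: continuous_coord | exact: cst_continuous].
apply: closedI; apply: closed_forall => i; apply: closed_imply.
  apply: closed_le_fun; last exact: cst_continuous.
  exact/continuous_norm_coord/cB.
by apply: closed_eq_fun; [exact: continuous_coord | exact: cst_continuous].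
Qed.

Lemma closed_usphere : closed (@usphere R n).
Proof.
rewrite (_ : usphere = [set x : E | dotv x x = 1]).
  apply: closed_eq_fun; last exact: cst_continuous.
  by apply: continuous_dotv => x P.
apply/seteqP; split=> x; rewrite /usphere /=.
  by rewrite -sqr_enorm => ->; rewrite expr1n.
by rewrite /enorm => ->; rewrite sqrtr1.
Qed.

Lemma closed_narrow_cone j eta : closed (narrow_cone j eta).
Proof.
rewrite (_ : narrow_cone j eta =
  [set u | forall i : 'I_n, (i < j)%N -> u 0 i = 0] `&` [set u | 0 <= u 0 j] `&`
  [set u | forall i : 'I_n, (j < i)%N -> `|u 0 i| <= eta * u 0 j]).
  apply: closedI; first apply: closedI.
  - apply: closed_forall => i; apply: closed_imply.
    by apply: closed_eq_fun; [exact: continuous_coord | exact: cst_continuous].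
  - by apply: closed_le_fun; [exact: cst_continuous | exact: continuous_coord].
  - apply: closed_forall => i; apply: closed_imply; apply: closed_le_fun.
      exact/continuous_norm_coord/continuous_coord.
    by move=> x; apply: continuousM; [exact: cst_continuous | exact: continuous_coord].
by apply/seteqP; split=> u /= => [[]|[[]]].
Qed.

Lemma flat_box_coord j x0 delta x i : 0 <= delta ->
  flat_box j x0 delta x -> `|x 0 i - x0 0 i| <= delta.
Proof.
move=> d0 [lo hi]; have [ij|ji] := ltnP i j; first exact: lo.
by rewrite (hi i ji) subrr normr0.
Qed.

(** The first [j] coordinates parametrize the box. *)
Lemma hausdorff_flat_box j x0 delta : (j <= n)%N -> 0 < delta ->
  (0 < hausdorff j (flat_box j x0 delta : set (borelE R n)) < +oo)%E.
Proof.
move=> jn d0; pose iota := widen_ord jn; set B := flat_box _ _ _.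
have Bx0 x i : B x -> `|x 0 i| <= `|x0| + delta.
  move=> Bx; rewrite -(subrKC (x0 0 i) (x 0 i)).
  apply: (le_trans (ler_normD _ _)); rewrite lerD ?coord_le_norm //.
  exact: flat_box_coord (ltW d0) Bx.
apply/andP; split.
  apply: (@hausdorff_gt0 R n j iota _ (fun i => x0 0 (iota i)) delta) => //.
    apply: (@compact_coord_bounded _ (`|x0| + delta)); first exact: closed_flat_box.
    by move=> x Bx i; exact: Bx0.
  move=> z zP; exists (\row_i if insub (val i) is Some i' then z i' else x0 0 i).
    split=> i ij; rewrite mxE; case: insubP => [i' lti i'i|]; rewrite ?ij //.
    - have -> : i = iota i' by exact: val_inj.
      by have /andP[z1 z2] := zP i'; rewrite ler_norml; lra.
    - by move: lti; rewrite /= ltnNge ij.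
  move=> i; rewrite mxE; case: insubP => [i' _ i'i|]; last by rewrite /= ltn_ord.
  by congr z; exact: val_inj.
apply: (@hausdorff_lty R n j iota _ n.+1%:R (`|x0| + delta)) => //.
- by rewrite ltr_wpDl.
- by move=> x Bx i; exact: Bx0.
move=> x y M [_ xhi] [_ yhi] M0 xyM; apply: le_trans (enorm_le_sum _) _.
apply: (@le_trans _ _ (\sum_(i < n) M)); last first.
  by rewrite sumr_const card_ord -[leLHS]mulr_natl ler_wpM2r // ler_nat.
apply: ler_sum => i _; rewrite !mxE; have [ij|ji] := ltnP i j.
  by have := xyM (Ordinal ij); rewrite (_ : iota _ = i) //; exact: val_inj.
by rewrite xhi // yhi // subrr normr0.
Qed.

Section cap.
Variables (j : 'I_n) (eta : R).
Hypotheses (eta0 : 0 < eta) (eta1 : n%:R * eta <= 1).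
Local Notation cap := (narrow_cone j eta `&` usphere).

Let n_gt0 : 0 < n%:R :> R.
Proof. by rewrite ltr0n (leq_ltn_trans _ (ltn_ord j)). Qed.

Let n_ge1 : 1 <= n%:R :> R.
Proof. by rewrite ler1n (leq_ltn_trans _ (ltn_ord j)). Qed.

Let eta_le1 : eta <= 1.
Proof. by apply: le_trans eta1; rewrite ler_peMl // ltW. Qed.

Let n_eta2 : n%:R * eta ^+ 2 <= n%:R * eta.
Proof. by rewrite ler_wpM2l // expr2 ler_piMl // ltW. Qed.

Lemma cap_sumE u : cap u -> \sum_(i < n | (j < i)%N) u 0 i ^+ 2 = 1 - u 0 j ^+ 2.
Proof.
move=> [[lo _ _] u1]; have := sqr_enorm u; rewrite u1 expr1n.
rewrite /dotv (bigD1 j) //= -expr2 => ->; rewrite addrAC subrr add0r.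
rewrite big_mkcond [RHS]big_mkcond /=; apply: eq_bigr => i _.
case: (ltngtP i j) => [ij|ji|/val_inj ->]; last by rewrite eqxx.
  by rewrite lo // mul0r; case: ifP.
by rewrite -expr2 ifT // -val_eqE /= gtn_eqF.
Qed.

Lemma cap_axis_le1 u : cap u -> u 0 j <= 1.
Proof.
by move=> [_ u1]; rewrite -u1 (le_trans (ler_norm _)) // coord_le_enorm.
Qed.

Lemma cap_axis_defect u : cap u -> 1 - u 0 j ^+ 2 <= n%:R * eta ^+ 2 * u 0 j ^+ 2.
Proof.
move=> cu; rewrite -(cap_sumE cu) big_mkcond /=.
have [[_ u0 hi] _] := cu.
apply: (@le_trans _ _ (\sum_(i < n) eta ^+ 2 * u 0 j ^+ 2)); last first.
  by rewrite sumr_const card_ord -[leLHS]mulr_natl mulrA.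
apply: ler_sum => i _; case: ifP => ji.
  rewrite -exprMn -(real_normK (num_real (u 0 i))).
  by rewrite lerXn2r ?nnegrE ?hi // mulr_ge0 // ltW.
by rewrite mulr_ge0 ?sqr_ge0.
Qed.

Lemma cap_axis_ge u : cap u -> 1 / 2 <= u 0 j.
Proof.
move=> cu; have [[_ u0 _] _] := cu.
have := cap_axis_defect cu; have := cap_axis_le1 cu.
have : n%:R * eta ^+ 2 <= 1 by exact: le_trans n_eta2 eta1.
move: (n%:R * eta ^+ 2) (u 0 j) u0 => K t t0 K1 t1 tK.
nra.
Qed.

Lemma cap_close u i : cap u -> `|u 0 i - (i == j)%:R| <= n%:R * eta.
Proof.
move=> cu; have [[lo u0 hi] _] := cu; have u1 := cap_axis_le1 cu.
have neta : eta <= n%:R * eta by rewrite ler_peMl // ltW.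
case: (ltngtP i j) => [ij|ji|/val_inj ->].
- rewrite lo // -val_eqE /= ltn_eqF // subr0 normr0.
  by rewrite mulr_ge0 // ltW.
- rewrite -val_eqE /= gtn_eqF // subr0 (le_trans (hi i ji)) //.
  by apply: le_trans neta; rewrite ler_piMr // ltW.
rewrite (_ : (j == j)%:R = 1 :> R) ?eqxx // ler_norml.
have := cap_axis_defect cu.
have t2 : u 0 j ^+ 2 <= u 0 j by rewrite expr2 ler_piMl.
have c2 : n%:R * eta ^+ 2 * u 0 j ^+ 2 <= n%:R * eta.
  have e2 : 0 <= n%:R * eta ^+ 2 by rewrite mulr_ge0 // sqr_ge0.
  by rewrite (le_trans _ n_eta2) // ler_piMr // (le_trans t2).
have ne0 : 0 <= n%:R * eta by rewrite mulr_ge0 // ltW.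
by move=> c1; apply/andP; split; lra.
Qed.

(** The cap is a graph over the [n - j - 1] coordinates beyond [j].  Its points
    stay away from the hyperplane orthogonal to axis [j], so the axial coordinate
    is a Lipschitz function of the transversal ones. *)
Lemma hausdorff_cap :
  (0 < hausdorff (n - j - 1) (cap : set (borelE R n)) < +oo)%E.
Proof.
have jn (i : 'I_(n - j - 1)) : (j.+1 + i < n)%N by have := ltn_ord i; lia.
pose iota i := Ordinal (jn i).
have cap1 u i : cap u -> `|u 0 i| <= 1.
  by move=> [_ <-]; exact: coord_le_enorm.
have iotaP (i : 'I_n) : (j < i)%N -> exists i', i = iota i'.
  move=> ji; have ii : (i - j.+1 < n - j - 1)%N by have := ltn_ord i; lia.
  by exists (Ordinal ii); apply: val_inj; rewrite /= subnKC.
apply/andP; split.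
  apply: (@hausdorff_gt0 R n _ iota _ (fun=> 0) (eta / 2)) => //.
  - by rewrite divr_gt0.
  - apply: (@compact_coord_bounded _ 1); last by move=> u cu i; exact: cap1.
    by apply: closedI; [exact: closed_narrow_cone | exact: closed_usphere].
  move=> z zP; pose s := \sum_i z i ^+ 2.
  have s_small : s <= 1 / 4.
    apply: (@le_trans _ _ (\sum_(i < n - j - 1) (eta / 2) ^+ 2)).
      apply: ler_sum => i _; have := zP i; rewrite add0r => /andP[z0 z1].
      by rewrite lerXn2r ?nnegrE // (le_trans z0).
    rewrite sumr_const card_ord -[leLHS]mulr_natl.
    apply: (@le_trans _ _ (n%:R * (eta / 2) ^+ 2)).
      by rewrite ler_wpM2r ?sqr_ge0 // ler_nat; lia.
    have := le_trans n_eta2 eta1; rewrite exprMn exprVn; lra.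
  pose t := Num.sqrt (1 - s).
  have t_ge : 1 / 2 <= t.
    rewrite -(ger0_norm (_ : 0 <= 1 / 2)) // -sqrtr_sqr ler_sqrt; nra.
  have t2 : t ^+ 2 = 1 - s by rewrite sqr_sqrtr //; lra.
  pose u : E := \row_i if i == j then t else
    if insub (i - j.+1)%N is Some i' then (if (j < i)%N then z i' else 0) else 0.
  have u_iota i : u 0 (iota i) = z i.
    rewrite mxE -val_eqE /= gtn_eqF ?addSn ?ltnS ?leq_addr //.
    case: insubP => [i' _ /= i'i|]; last by rewrite subSS addKn ltn_ord.
    by congr z; apply: val_inj => /=; move: i'i; lia.
  have u_j : u 0 j = t by rewrite mxE eqxx.
  have u_lo (i : 'I_n) : (i < j)%N -> u 0 i = 0.
    move=> ij; rewrite mxE -val_eqE /= ltn_eqF //.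
    by case: insub => // i'; rewrite ltnNge ltnW.
  exists u => //; split.
    split=> //; first by rewrite u_j; lra.
    move=> i /iotaP[i' ->]; rewrite u_iota u_j.
    have := zP i'; rewrite add0r => /andP[z0 z1]; rewrite ger0_norm //; nra.
  rewrite /usphere /= /enorm -[RHS]sqrtr1; congr Num.sqrt.
  rewrite /dotv (bigD1 j) //= u_j -expr2 t2 -[RHS](subrK s); congr (_ + _).
  have iota_inj : {in [set: 'I_(n - j - 1)]%SET &, injective iota}.
    by move=> i i' _ _ /(congr1 val) /= /addnI /val_inj.
  transitivity (\sum_(i in [set iota i | i in [set: 'I_(n - j - 1)]]%SET) u 0 i ^+ 2).
    rewrite big_mkcond [RHS]big_mkcond /=; apply: eq_bigr => i _.
    rewrite -expr2; case: (ltngtP i j) => [ij|ji|/val_inj ->].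
    - by rewrite u_lo // expr0n /=; case: ifP => _; case: ifP.
    - have [i' ii'] := iotaP i ji.
      have -> : i \in [set iota i0 | i0 in [set: 'I_(n - j - 1)]]%SET.
        by rewrite ii' imset_f ?inE.
      rewrite ifT //.
      by rewrite -val_eqE /= gtn_eqF.
    - rewrite eqxx /=; case: imsetP => // -[i' _ /(congr1 val) /= ji'].
      by exfalso; move: ji'; lia.
  rewrite big_imset //= /s; apply: eq_big => [i|i _]; first by rewrite inE.
  by rewrite u_iota.
apply: (@hausdorff_lty R n _ iota _ (n%:R * (2 * n%:R + 1)) 1) => //.
- by rewrite mulr_gt0 // ltr_wpDl // mulr_ge0.
- by move=> u cu i; exact: cap1.
move=> u v M cu cv M0 uvM.
have uv_hi (i : 'I_n) : (j < i)%N -> `|u 0 i - v 0 i| <= M.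
  by move=> /iotaP[i' ->].
have uv_j : `|u 0 j - v 0 j| <= 2 * n%:R * M.
  have uj := cap_axis_ge cu; have vj := cap_axis_ge cv.
  apply: (@le_trans _ _ `|u 0 j ^+ 2 - v 0 j ^+ 2|).
    rewrite subr_sqr normrM ler_peMr // ger0_norm; lra.
  have -> : u 0 j ^+ 2 - v 0 j ^+ 2 =
      \sum_(i < n | (j < i)%N) (v 0 i ^+ 2 - u 0 i ^+ 2).
    by rewrite sumrB (cap_sumE cu) (cap_sumE cv); ring.
  apply: le_trans (ler_norm_sum _ _ _) _; rewrite big_mkcond /=.
  apply: (@le_trans _ _ (\sum_(i < n) 2 * M)); last first.
    by rewrite sumr_const card_ord -[leLHS]mulr_natl; lra.
  apply: ler_sum => i _; case: ifP => [ji|_]; last lra.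
  rewrite subr_sqr normrM mulrC ler_pM //; last by rewrite distrC uv_hi.
  by rewrite (le_trans (ler_normD _ _)) // -[2]/(1 + 1) lerD ?cap1.
apply: le_trans (enorm_le_sum _) _.
apply: (@le_trans _ _ (\sum_(i < n) (2 * n%:R + 1) * M)); last first.
  by rewrite sumr_const card_ord -[leLHS]mulr_natl mulrA.
apply: ler_sum => i _; rewrite !mxE.
have [[ulo _ _] _] := cu; have [[vlo _ _] _] := cv.
case: (ltngtP i j) => [ij|ji|/val_inj ->].
- by rewrite ulo // vlo // subrr normr0 mulr_ge0 // addr_ge0 // mulr_ge0.
- by rewrite (le_trans (uv_hi i ji)) // ler_peMl // lerDr mulr_ge0.
- by rewrite (le_trans uv_j) // ler_wpM2r // lerDl.
Qed.

End cap.

End test_sets.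

(** * A polytope with a prescribed face and a narrow normal cone *)

Section convex_hulls.
Context {R : realType} {n : nat}.
Local Notation E := 'rV[R]_n.
Implicit Types (s : seq E) (x u : E).

Lemma dotvDr u x y : dotv u (x + y) = dotv u x + dotv u y.
Proof. by rewrite -big_split; apply: eq_bigr => i _; rewrite mxE mulrDr. Qed.

Lemma dotvZr u a x : dotv u (a *: x) = a * dotv u x.
Proof. by rewrite mulr_sumr; apply: eq_bigr => i _; rewrite mxE mulrCA. Qed.

Lemma dotvC u x : dotv u x = dotv x u.
Proof. by apply: eq_bigr => i _; rewrite mulrC. Qed.

Lemma dotvNr u x : dotv u (- x) = - dotv u x.
Proof. by rewrite -scaleN1r dotvZr mulN1r. Qed.

Lemma dotvBr u x y : dotv u (x - y) = dotv u x - dotv u y.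
Proof. by rewrite dotvDr dotvNr. Qed.

Lemma dotv0r u : dotv u 0 = 0.
Proof. by rewrite -(scale0r (0 : E)) dotvZr mul0r. Qed.

Lemma dotv_sumr (I : finType) u (F : I -> E) :
  dotv u (\sum_i F i) = \sum_i dotv u (F i).
Proof. by apply: (big_morph (dotv u) (dotvDr u) (dotv0r u)). Qed.

Lemma conv_hull_dotv_le s u c x :
  (forall v, v \in s -> dotv u v <= c) -> conv_hull s x -> dotv u x <= c.
Proof.
move=> sc [w [w0 w1 ->]]; rewrite dotv_sumr -[c]mul1r -w1 mulr_suml.
by apply: ler_sum => i _; rewrite dotvZr ler_wpM2l ?sc // mem_nth.
Qed.

Lemma mem_conv_hull s v : v \in s -> conv_hull s v.
Proof.
move=> vs; have vi : (seq.index v s < size s)%N by rewrite index_mem.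
exists (fun i => (i == Ordinal vi)%:R); split=> [i||]; first exact: ler0n.
  by rewrite (bigD1 (Ordinal vi)) //= eqxx big1 ?addr0 // => i /negbTE ->.
rewrite (bigD1 (Ordinal vi)) //= eqxx scale1r nth_index // big1 ?addr0 //.
by move=> i /negbTE ->; rewrite scale0r.
Qed.

Lemma conv_hull_sum (I : finType) s (w : I -> R) (p : I -> E) :
  (forall i, 0 <= w i) -> \sum_i w i = 1 -> (forall i, conv_hull s (p i)) ->
  conv_hull s (\sum_i w i *: p i).
Proof.
move=> w0 w1 /choice[W WP]; exists (fun k => \sum_i w i * W i k); split.
- by move=> k; apply: sumr_ge0 => i _; have [W0 _ _] := WP i; rewrite mulr_ge0.
- rewrite exchange_big /= -[RHS]w1; apply: eq_bigr => i _.
  by have [_ W1 _] := WP i; rewrite -mulr_sumr W1 mulr1.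
under [RHS]eq_bigr do rewrite scaler_suml.
rewrite exchange_big /=; apply: eq_bigr => i _; have [_ _ {1}->] := WP i.
by rewrite scaler_sumr; apply: eq_bigr => k _; rewrite scalerA.
Qed.

Lemma conv_hull_segment s x y (t : R) : 0 <= t <= 1 ->
  conv_hull s x -> conv_hull s y -> conv_hull s (t *: x + (1 - t) *: y).
Proof.
move=> /andP[t0 t1] sx sy.
have := @conv_hull_sum bool s (fun b => if b then t else 1 - t)
  (fun b => if b then x else y).
rewrite !big_bool /=; apply => [[]||[]] //; rewrite ?subr_ge0 //.
by rewrite subrKC.
Qed.

End convex_hulls.

Section coordinate_subspace.
Context {R : realType} {n : nat}.
Local Notation E := 'rV[R]_n.

(** This vanishes for [n <= k], which makes [k = n] a harmless boundary case. *)
Definition axis (k : nat) : E := \row_(i < n) (i == k :> nat)%:R.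

Lemma dotv_axis (u : E) (i : 'I_n) : dotv u (axis i) = u 0 i.
Proof.
rewrite /dotv (bigD1 i) //= mxE eqxx mulr1 big1 ?addr0 // => k ki.
by rewrite mxE (_ : (k == i :> nat) = false) ?mulr0 //; apply/negbTE.
Qed.

Definition axes (j : nat) : j.-tuple E := [tuple axis i | i < j].

Definition coord_space (j : nat) : {vspace E} := <<axes j>>%VS.

Lemma nth_axes j (i : 'I_j) : (axes j)`_i = axis i.
Proof. by rewrite -tnth_nth tnth_mktuple. Qed.

Lemma axis_in_coord_space j i : (i < j)%N -> axis i \in coord_space j.
Proof.
by move=> ij; apply/memv_span/mapP; exists (Ordinal ij); rewrite ?mem_enum.
Qed.

Lemma coord_spaceP j (x : E) : (j <= n)%N ->
  reflect (forall i : 'I_n, (j <= i)%N -> x 0 i = 0) (x \in coord_space j).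
Proof.
move=> jn; apply: (iffP idP) => [/coord_span -> i ji|x0].
  rewrite summxE big1 // => k _; rewrite nth_axes !mxE.
  by rewrite (_ : (i == k :> nat) = false) ?mulr0 // gtn_eqF // (leq_trans _ ji).
have -> : x = \sum_(i < n) x 0 i *: axis i.
  apply/rowP => k; rewrite summxE (bigD1 k) //= !mxE eqxx mulr1 big1 ?addr0 //.
  move=> i ik; rewrite !mxE (_ : (k == i :> nat) = false) ?mulr0 //.
  by apply/negbTE; rewrite eq_sym.
apply: memv_suml => i _; have [ij|ji] := ltnP i j.
  exact/memvZ/axis_in_coord_space.
by rewrite x0 // scale0r mem0v.
Qed.

Lemma dim_coord_space j : (j <= n)%N -> \dim (coord_space j) = j.
Proof.
move=> jn; suff /eqP -> : free (axes j) by rewrite size_tuple.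
apply/freeP => k /rowP k0 i; have := k0 (widen_ord jn i); rewrite summxE mxE.
rewrite (bigD1 i) //= nth_axes !mxE eqxx mulr1 big1 ?addr0 // => i' ii'.
rewrite nth_axes !mxE (_ : (i == i' :> nat) = false) ?mulr0 //.
by apply/negbTE; rewrite eq_sym.
Qed.

End coordinate_subspace.

Section directions.
Context {R : realType} {n : nat}.
Local Notation E := 'rV[R]_n.

Lemma dotv_eq0 (x : E) : dotv x x = 0 -> x = 0.
Proof.
move=> /eqP; rewrite /dotv psumr_eq0 => [/allP x0|i _]; last by rewrite -expr2 sqr_ge0.
apply/rowP => i; rewrite mxE; apply/eqP.
by have := x0 i (mem_index_enum i); rewrite /= mulf_eq0 orbb.
Qed.

Lemma oproj_eq (V : {vspace E}) (x z : E) : z \in V ->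
  (forall w, w \in V -> dotv (x - z) w = 0) -> oproj V x = z.
Proof.
move=> Vz xz; have [Vp xp] := oprojP V x; apply/eqP; rewrite -subr_eq0.
have Vd : oproj V x - z \in V by rewrite memvB.
apply/eqP/dotv_eq0; set d := _ - z in Vd *.
have -> : dotv d d = dotv d (x - z) - dotv d (x - oproj V x).
  by rewrite -dotvBr opprB [_ + (_ - x)]addrC addrA subrK.
by rewrite !(dotvC d) xz // xp // subrr.
Qed.

Lemma direction_eq (F : set E) (V : {vspace E}) :
  is_direction F V -> direction F = V.
Proof.
move=> [FV minV]; have [FD minD] := directionP F.
by apply/eqP; rewrite eqEsubv minD ?minV.
Qed.

Lemma direction_sub (F G : set E) : F `<=` G -> (direction F <= direction G)%VS.
Proof.
move=> FG; have [_ minF] := directionP F; have [GD _] := directionP G.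
by apply: minF => x y /FG Gx /FG Gy; exact: GD.
Qed.

End directions.

Lemma sum_option (V : nmodType) (I : finType) (F : option I -> V) :
  \sum_o F o = F None + \sum_i F (Some i).
Proof.
rewrite (bigD1 None) //=; congr (_ + _); rewrite (reindex_omap Some id) /=.
  by apply: eq_bigl => i; rewrite eqxx.
by case.
Qed.

Section wedge.
Context {R : realType} {n : nat}.
Local Notation E := 'rV[R]_n.
Variables (j : nat) (eta : R) (x0 : E).
Hypotheses (jn : (j <= n)%N) (eta0 : 0 < eta).

(** The first [j] axes, with both signs, span a cross-polytope, which will be the
    prescribed face; the other vertices generate the cone polar to
    [narrow_cone j eta]. *)
Definition wedge_ray (i : 'I_n) (s : bool) : E :=
  if (i < j)%N then (-1) ^+ s *: axis i else
  if i == j :> nat then - axis j else (-1) ^+ s *: axis i - eta *: axis j.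

Definition wedge_vertices : seq E :=
  x0 :: [seq x0 + wedge_ray p.1 p.2 | p : 'I_n * bool].

Definition wedge : set E := conv_hull wedge_vertices.

Definition wedge_edge : set E :=
  wedge `&` [set x | forall i : 'I_n, (j <= i)%N -> x 0 i = x0 0 i].

Lemma wedge_is_polytope : is_polytope wedge.
Proof. by exists wedge_vertices. Qed.

Lemma wedge_ray_in i s : wedge (x0 + wedge_ray i s).
Proof.
apply: mem_conv_hull; rewrite inE; apply/orP; right.
by apply/mapP; exists (i, s) => //; rewrite mem_enum.
Qed.

Lemma wedge_dotv_le u c x : 0 <= c ->
  (forall i s, dotv u (wedge_ray i s) <= c) -> wedge x -> dotv u (x - x0) <= c.
Proof.
move=> c0 uc; rewrite dotvBr lerBlDr; apply: conv_hull_dotv_le => v.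
rewrite inE => /predU1P[->|/mapP[[i s] _ ->]]; first by rewrite lerDr.
by rewrite dotvDr addrC lerD2r.
Qed.

Lemma wedge_edge_base : wedge_edge x0.
Proof. by split=> //; apply: mem_conv_hull; rewrite inE eqxx. Qed.

Lemma wedge_edge_axis (i : 'I_n) (s : bool) :
  (i < j)%N -> wedge_edge (x0 + (-1) ^+ s *: axis i).
Proof.
move=> ij; split; first by have := wedge_ray_in i s; rewrite /wedge_ray ij.
move=> k jk; rewrite !mxE (_ : (k == i :> nat) = false) ?mulr0 ?addr0 //.
by rewrite gtn_eqF // (leq_trans ij).
Qed.

Lemma direction_wedge_edge : direction wedge_edge = coord_space j.
Proof.
apply: direction_eq; split=> [x y [_ xe] [_ ye]|W eW].
  by apply/coord_spaceP => // i ji; rewrite !mxE xe // ye // subrr.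
apply/span_subvP => _ /mapP[i _ ->].
have := eW _ _ (@wedge_edge_axis (widen_ord jn i) false (ltn_ord i)) wedge_edge_base.
by rewrite expr0 scale1r addrC addKr.
Qed.

Lemma dotv_wedge_ray u (j' : 'I_n) i s : j' = j :> nat ->
  dotv u (wedge_ray i s) = if (i < j)%N then (-1) ^+ s * u 0 i else
    if i == j :> nat then - u 0 j' else (-1) ^+ s * u 0 i - eta * u 0 j'.
Proof.
move=> j'j; rewrite /wedge_ray -j'j; case: ifP => _.
  by rewrite dotvZr dotv_axis.
by case: ifP => _; rewrite ?dotvBr ?dotvNr ?dotvZr !dotv_axis.
Qed.

Lemma narrow_cone_dotv_le (j' : 'I_n) u x : j' = j :> nat ->
  narrow_cone j' eta u -> wedge x -> dotv u (x - x0) <= 0.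
Proof.
move=> j'j [ulo u0 uhi]; apply: wedge_dotv_le => // i s.
rewrite (dotv_wedge_ray _ _ _ j'j) -j'j.
case: (ltngtP i j') => [/ulo ->|/uhi|_]; rewrite ?mulr0 ?oppr_le0 // => ui.
rewrite subr_le0 (le_trans _ ui) // (le_trans (ler_norm _)) //.
by rewrite normrM normrX normrN1 expr1n mul1r.
Qed.

(** Testing a normal vector against the vertices gives exactly the inequalities
    that define the narrow cone. *)
Lemma normal_cone_wedge_edge (j' : 'I_n) : j' = j :> nat ->
  normal_cone wedge wedge_edge = narrow_cone j' eta.
Proof.
move=> j'j; apply/seteqP; split=> u.
  move=> uN; have ray i s : dotv u (wedge_ray i s) <= 0.
    by have := uN _ _ wedge_edge_base (wedge_ray_in i s); rewrite addrC addKr.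
  split.
  - move=> i ij; have := ray i true; have := ray i false.
    rewrite !(dotv_wedge_ray _ _ _ j'j) -j'j ij expr0 expr1; lra.
  - by have := ray j' false; rewrite (dotv_wedge_ray _ _ _ j'j) -j'j ltnn eqxx; lra.
  - move=> i ji; have := ray i true; have := ray i false.
    rewrite !(dotv_wedge_ray _ _ _ j'j) -j'j ltnNge ltnW //= gtn_eqF //.
    by rewrite expr0 expr1 ler_norml => *; apply/andP; split; lra.
move=> uN x y [_ xe] wy.
rewrite -(subrKA x0) dotvDr [X in _ + X](_ : _ = 0).
  by rewrite addr0 (narrow_cone_dotv_le j'j).
rewrite /dotv big1 // => i _; rewrite !mxE; have [ulo _ _] := uN.
have [ij|ji] := ltnP i j; first by rewrite ulo ?j'j // mul0r.
by rewrite xe // subrr mulr0.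
Qed.

(** Tilting axis [j] by [eta] in a transversal direction does not leave the narrow
    cone; the two opposite tilts bound the transversal coordinate by [0] where the
    axial one is maximal. *)
Lemma wedge_tip (j' : 'I_n) x : j' = j :> nat -> wedge x ->
  x 0 j' <= x0 0 j' /\ (x 0 j' = x0 0 j' -> wedge_edge x).
Proof.
move=> j'j wx.
have cone_axis : narrow_cone j' eta (axis j').
  split=> [i ij||i ji]; rewrite !mxE ?eqxx //; first by rewrite ltn_eqF.
  by rewrite gtn_eqF // normr0 mulr1 ltW.
split.
  have := narrow_cone_dotv_le j'j cone_axis wx.
  by rewrite dotvC dotv_axis !mxE subr_le0.
move=> xj; split=> // i; rewrite -j'j leq_eqVlt => /predU1P[/val_inj <- //|ji].
have tilt (s : bool) : narrow_cone j' eta (axis j' + (-1) ^+ s * eta *: axis i).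
  split=> [k kj||k jk]; rewrite !mxE ?eqxx.
  - by rewrite (ltn_eqF kj) (ltn_eqF (ltn_trans kj ji)) /= !mulr0n mulr0 addr0.
  - by rewrite (ltn_eqF ji) /= mulr0n mulr0 addr0 ler01.
  - rewrite (gtn_eqF jk) (ltn_eqF ji) /= !mulr0n add0r mulr0 addr0 mulr1n mulr1.
    rewrite !normrM normrX normrN1 expr1n mul1r (gtr0_norm eta0) ler_piMr ?(ltW eta0) //.
    by case: eqP => _; rewrite ?normr1 ?normr0.
have := narrow_cone_dotv_le j'j (tilt true) wx.
have := narrow_cone_dotv_le j'j (tilt false) wx.
rewrite !(dotvC _ (x - x0)) !dotvDr !dotvZr !dotv_axis !mxE xj subrr !add0r.
rewrite expr0 expr1 mul1r mulN1r mulNr pmulr_rle0 // oppr_le0 pmulr_rge0 //.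
by move=> h1 h2; apply/eqP; rewrite -subr_eq0 eq_le h1.
Qed.

(** The edge is the set where axis [j] attains its maximum over the wedge. *)
Lemma wedge_edge_face : face wedge wedge_edge.
Proof.
split.
- by exists x0; exact: wedge_edge_base.
- by move=> x [].
- apply/convex_setW => x y /set_mem [wx xe] /set_mem [wy ye] t t0 t1.
  apply/mem_set; split.
    apply: conv_hull_segment => //; by rewrite ?ltW.
  move=> i ji.
  have e (a b : E) : a 0 i = x0 0 i -> b 0 i = x0 0 i ->
    (t%:num *: a + (1 - t%:num) *: b) 0 i = x0 0 i.
    by move=> ai bi; rewrite !mxE ai bi; ring.
  exact: (e _ _ (xe i ji) (ye i ji)).
move=> x y t wx wy t01 [_ xye].
have /andP[t0 t1] := t01.
have [jlt|] := ltnP j n; last first.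
  move=> nj; split; split=> // i; rewrite leqNgt (leq_trans (ltn_ord i)) //.
have j'j : Ordinal jlt = j :> nat by [].
have [xle xtip] := wedge_tip j'j wx; have [yle ytip] := wedge_tip j'j wy.
have := xye (Ordinal jlt) (leqnn _); rewrite !mxE => xy.
by split; [apply: xtip | apply: ytip]; nra.
Qed.

(** A vector whose coordinates have absolute sum at most [1] is a convex
    combination of [0] and of signed axes. *)
Lemma flat_box_wedge_edge (delta : R) : 0 <= delta ->
  n%:R * delta <= 1 -> flat_box j x0 delta `<=` wedge_edge.
Proof.
move=> d0 d1 x [lo hi]; split=> //.
pose z i := x 0 i - x0 0 i.
pose w (o : option 'I_n) := if o is Some i then `|z i| else 1 - \sum_i `|z i|.
pose p (o : option 'I_n) : E := if o is Some i then
  (if (i < j)%N then x0 + (-1) ^+ (z i < 0)%R *: axis i else x0) else x0.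
have zle : \sum_i `|z i| <= 1.
  apply: le_trans d1; apply: (@le_trans _ _ (\sum_(i < n) delta)).
    apply: ler_sum => i _; rewrite /z; have [ij|ji] := ltnP i j; first exact: lo.
    by rewrite hi // subrr normr0.
  by rewrite sumr_const card_ord -[leLHS]mulr_natl.
have w1 : \sum_o w o = 1 by rewrite sum_option subrK.
have <- : \sum_o w o *: p o = x.
  have pE i : w (Some i) *: p (Some i) = `|z i| *: x0 + z i *: axis i.
    rewrite /p /=; case: ifP => ij.
      rewrite scalerDr scalerA; congr (_ + _ *: _).
      by rewrite mulrC mulr_sign_norm.
    by rewrite (_ : z i = 0) ?scale0r ?addr0 // /z hi ?subrr // leqNgt ij.
  rewrite sum_option (eq_bigr _ (fun i _ => pE i)).
  rewrite big_split /= -scaler_suml addrA -scalerDl subrK scale1r.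
  apply/rowP => k; rewrite mxE summxE (bigD1 k) //= !mxE eqxx mulr1 big1 ?addr0.
    by rewrite subrKC.
  move=> i ik; rewrite !mxE (_ : (k == i :> nat) = false) ?mulr0 //.
  by apply/negbTE; rewrite eq_sym.
apply: conv_hull_sum => //.
- by case=> [i|] /=; rewrite ?subr_ge0.
- case=> [i|] /=; last by have [] := wedge_edge_base.
  have [base _] := wedge_edge_base; case: ifP => // ij.
  by have [] := wedge_edge_axis (z i < 0)%R ij.
Qed.

Lemma wedge_edge_coord x i : wedge_edge x -> `|x 0 i - x0 0 i| <= 1.
Proof.
move=> [wx xe]; have [ij|/xe->] := ltnP i j; last by rewrite subrr normr0.
have ray1 (i' : 'I_n) s : `|wedge_ray i' s 0 i| <= 1.
  have axis1 k : `|@axis R n k 0 i| <= 1.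
    by rewrite mxE; case: eqP => _; rewrite ?normr1 ?normr0.
  have axisj : @axis R n j 0 i = 0 by rewrite mxE ltn_eqF.
  rewrite /wedge_ray; case: ifP => _; last case: ifP => _.
  - by rewrite mxE normrM normrX normrN1 expr1n mul1r.
  - by rewrite mxE axisj oppr0 normr0.
  - have subE (a b : E) : (a - b) 0 i = a 0 i - b 0 i by rewrite !mxE.
    have sclE c (a : E) : (c *: a) 0 i = c * a 0 i by rewrite mxE.
    by rewrite subE !sclE axisj mulr0 subr0 normrM normrX normrN1 expr1n mul1r.
rewrite ler_norml; apply/andP; split.
  rewrite lerNl; have := @wedge_dotv_le (- axis i) 1 x ler01.
  rewrite dotvC dotvNr dotv_axis !mxE; apply => // i' s.
  by rewrite dotvC dotvNr dotv_axis; have /ler_normlP[] := ray1 i' s.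
have := @wedge_dotv_le (axis i) 1 x ler01.
rewrite dotvC dotv_axis !mxE; apply => // i' s.
by rewrite dotvC dotv_axis; have /ler_normlP[] := ray1 i' s.
Qed.

(** Points of a small box around [x0] are relative interior points of the edge:
    every segment from a point of the edge to such a point can be prolonged
    inside the edge. *)
Lemma wedge_edge_sub_face (delta : R) (G : set E) x : (0 < n)%N -> 0 <= delta ->
  n%:R * delta <= 1 / 4 -> face wedge G -> G x -> flat_box j x0 delta x ->
  wedge_edge `<=` G.
Proof.
move=> n0 d0 d1 [_ _ _ Gext] Gx Bx f Ff.
have nR : 0 < n%:R :> R by rewrite ltr0n.
have n1 : 1 <= n%:R :> R by rewrite ler1n.
(* [delta + t * (delta + 1)] stays below [1 / n], the size of the box known to lie
   in the edge. *)
pose t : R := (4 * n%:R)^-1.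
have t0 : 0 < t by rewrite invr_gt0 mulr_gt0.
have nt : n%:R * t = 1 / 4 by rewrite /t; field; rewrite gt_eqF.
have [_ fe] := Ff; have [_ xe] := Bx.
have edge' : wedge_edge (x + t *: (x - f)).
  apply: (@flat_box_wedge_edge n%:R^-1); first by rewrite invr_ge0 ltW.
    by rewrite divff // gt_eqF.
  split=> i; last by move=> ji; rewrite !mxE xe // fe // subrr mulr0 addr0.
  move=> ij; rewrite -(ler_pM2l nR) divff ?gt_eqF // !mxE.
  have := flat_box_coord i d0 Bx; have := wedge_edge_coord i Ff.
  move: (x 0 i) (f 0 i) (x0 0 i) => a b c bc ac.
  have dn : delta <= n%:R * delta by rewrite ler_peMl.
  apply: (@le_trans _ _ (n%:R * (delta + t * (delta + 1)))).
    rewrite ler_wpM2l ?(ltW nR) // (_ : _ - c = (a - c) + t * ((a - c) - (b - c))).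
      rewrite (le_trans (ler_normD _ _)) // lerD // normrM gtr0_norm //.
      by rewrite ler_wpM2l ?(ltW t0) // (le_trans (ler_normB _ _)) // lerD.
    ring.
  have -> : n%:R * (delta + t * (delta + 1)) =
    n%:R * delta + n%:R * t * delta + n%:R * t by ring.
  rewrite nt; lra.
have t1 : 0 < 1 + t by rewrite addr_gt0.
have /Gext[] // : G (t / (1 + t) *: f + (1 - t / (1 + t)) *: (x + t *: (x - f))).
  suff -> : t / (1 + t) *: f + (1 - t / (1 + t)) *: (x + t *: (x - f)) = x by [].
  by apply/rowP => i; rewrite !mxE; field; rewrite gt_eqF.
- by have [] := Ff.
- by have [] := edge'.
- by rewrite divr_gt0 //= ltr_pdivrMr // mul1r ltrDr.
Qed.

(** A face meeting the box contains the edge, so its direction space contains that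
    of the edge; equality of dimensions forces equality of the faces. *)
Lemma face_meeting_box (delta : R) (k : nat) (G : set E) : (0 < n)%N -> 0 <= delta ->
  n%:R * delta <= 1 / 4 -> (k <= j)%N -> faces k wedge G ->
  G `&` flat_box j x0 delta !=set0 -> k = j /\ G = wedge_edge.
Proof.
move=> n0 d0 d1 kj [Gface dimG] [x [Gx Bx]].
have edgeG := wedge_edge_sub_face n0 d0 d1 Gface Gx Bx.
have := direction_sub edgeG; rewrite direction_wedge_edge => dirle.
have kE : k = j.
  apply/eqP; rewrite eqn_leq kj -dimG -{1}(@dim_coord_space R n j jn).
  exact: dimvS.
have dirE : direction G = coord_space j.
  by apply/esym/eqP; rewrite eqEdim dirle dimG (@dim_coord_space R n j jn) kE /=.
split=> //; apply/seteqP; split=> // g Gg.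
have [_ Gw _ _] := Gface; split=> [|i ji]; first exact: Gw.
have [GD _] := directionP G.
have := GD _ _ Gg (edgeG _ wedge_edge_base); rewrite dirE.
by move=> /(coord_spaceP _ jn) /(_ i ji); rewrite !mxE => /eqP; rewrite subr_eq0 => /eqP.
Qed.

Lemma wedge_edge_faces : faces j wedge wedge_edge.
Proof.
by split; [exact: wedge_edge_face | rewrite direction_wedge_edge dim_coord_space].
Qed.

End wedge.

(** * Evaluation of the valuations on the diagonal *)

Section diagonal.
Context {R : realType} {n : nat}.
Local Notation E := 'rV[R]_n.
Implicit Types (y : E).

(** On the diagonal all permutations contribute the same term, so symmetrisation
    is invisible and symmetric tensors multiply like polynomials. *)
Lemma tmul_diag p q (a : tensor R n p) (b : tensor R n q) y :
  tmul a b (fun=> y) = a (fun=> y) * b (fun=> y).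
Proof.
have mean (c : R) N : (0 < N)%N -> N%:R^-1 * (c *+ N) = c.
  by move=> N0; rewrite -[c *+ N]mulr_natl mulKf // pnatr_eq0 -lt0n.
by rewrite /tmul sumr_const card_Sn; apply: mean; exact: fact_gt0.
Qed.

Lemma tcast_diag p q (e : p = q) (a : tensor R n p) y :
  Defs.tcast e a (fun=> y) = a (fun=> y).
Proof. by []. Qed.

Lemma tpow_diag p (a : tensor R n p) k y :
  tpow a k (fun=> y) = a (fun=> y) ^+ k.
Proof. by elim: k => //= k IHk; rewrite tmul_diag IHk exprS. Qed.

Lemma moment_diag j (A : set (borelE R n)) r y : moment j A r (fun=> y) =
  \int[hausdorff j]_(x in A) (dotv (x : E) y ^+ r).
Proof.
congr fine; apply: eq_integral => x _.
by rewrite /vpow prodr_const card_ord.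
Qed.

Lemma moment_set0 j r : moment j (set0 : set (borelE R n)) r = 0.
Proof.
apply/funext => v; rewrite /moment.
by rewrite (@integral_set0 _ _ _ (hausdorff j : {measure set (borelE R n) -> \bar R})).
Qed.

Lemma tmul0r p q (b : tensor R n q) : tmul (0 : tensor R n p) b = 0.
Proof.
apply/funext => v; rewrite /tmul big1 ?mulr0 // => sigma _.
exact: mul0r.
Qed.

Lemma tmulr0 p q (a : tensor R n p) : tmul a (0 : tensor R n q) = 0.
Proof.
apply/funext => v; rewrite /tmul big1 ?mulr0 // => sigma _.
exact: mulr0.
Qed.

Definition proj_sqnorm (j : nat) y : R :=
  dotv (oproj (coord_space j) y) (oproj (coord_space j) y).

Section wedge_values.
Variables (j : nat) (eta delta : R) (x0 : E).
Hypotheses (jn : (j <= n)%N) (n_gt0 : (0 < n)%N) (eta0 : 0 < eta)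
  (delta0 : 0 <= delta) (delta1 : n%:R * delta <= 1 / 4).
Local Notation P := (wedge j eta x0).
Local Notation B := (flat_box j x0 delta : set (borelE R n)).

Let delta_le1 : n%:R * delta <= 1.
Proof. by apply: le_trans delta1 _; lra. Qed.

Let box_sub_edge : flat_box j x0 delta `<=` wedge_edge j eta x0.
Proof. exact: flat_box_wedge_edge. Qed.

Lemma phi_wedge_lt k r s l : (k < j)%N -> phi k r s l P B = 0.
Proof.
move=> kj; have kn : (k < n)%N by exact: leq_trans kj jn.
rewrite /phi kn /phi_lower fsbig1 ?scaler0 // => F Fk.
have [FB0|/eqP/set0P FB] := pselect (F `&` B = set0).
  by rewrite FB0 moment_set0 tmul0r tmulr0.
have [kE _] := face_meeting_box jn n_gt0 delta0 delta1 (ltnW kj) Fk FB.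
by move: kj; rewrite kE ltnn.
Qed.

Lemma phi_wedge (j' : 'I_n) r s l y : j' = j :> nat ->
  phi j r s l P B (fun=> y) = @coef R n j r s l / omega R (n - j) *
    (proj_sqnorm j y ^+ l *
     (\int[hausdorff j]_(x in B) (dotv (x : E) y ^+ r) *
      \int[hausdorff (n - j - 1)]_(u in (narrow_cone j' eta `&` usphere :
        set (borelE R n))) (dotv (u : E) y ^+ s))).
Proof.
move=> j'j; have jlt : (j < n)%N by rewrite -j'j.
rewrite /phi jlt /phi_lower -(@fsbig_widen _ _ _ _ [set wedge_edge j eta x0]).
- rewrite fsbig_set1 [LHS]/(_ * _ : R); congr (_ * _).
  rewrite !tmul_diag tpow_diag !moment_diag /face_metric.
  rewrite direction_wedge_edge // (normal_cone_wedge_edge eta x0 j'j).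
  by rewrite setIC (setIidl box_sub_edge).
- by move=> F ->; exact: wedge_edge_faces.
- move=> F [Fj /= Fne].
  have [FB0|/eqP/set0P FB] := pselect (F `&` B = set0).
    by rewrite FB0 moment_set0 tmul0r tmulr0.
  by have [_ /Fne] := face_meeting_box jn n_gt0 delta0 delta1 (leqnn _) Fj FB.
Qed.

Lemma phi_wedge_full r l y : j = n ->
  phi j r 0 l P B (fun=> y) = (r`!%:R^-1 * (omega R (n + 2 * l) / omega R n)) *
    (dotv y y ^+ l * \int[hausdorff j]_(x in B) (dotv (x : E) y ^+ r)).
Proof.
move=> jE; rewrite /phi {1}jE ltnn.
rewrite [LHS]/(_ * tmul _ _ _ : R); congr (_ * _).
rewrite tmul_diag tpow_diag (_ : moment n _ r = moment j (P `&` B) r).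
  by rewrite moment_diag setIidr // => x /box_sub_edge[].
by rewrite jE.
Qed.

End wedge_values.

End diagonal.

(** * Shrinking the test sets *)

(** The factor [4 * n] puts boxes of this size in the relative interior of the
    edge of the wedge, whatever [k]. *)
Definition width {R : realType} (n k : nat) : R := (4 * n%:R * k.+1%:R)^-1.

Section limits.
Context {R : realType} {n : nat}.
Hypothesis n_gt0 : (0 < n)%N.
Local Notation E := 'rV[R]_n.
Implicit Types (x y : E).


Lemma width_gt0 k : 0 < width n k :> R.
Proof. by rewrite invr_gt0 !mulr_gt0 ?ltr0n. Qed.

Lemma width_le k : n%:R * width n k <= 1 / 4 :> R.
Proof.
rewrite /width; have nR : n%:R != 0 :> R by rewrite pnatr_eq0 -lt0n.
rewrite (_ : n%:R * _ = 1 / 4 / k.+1%:R).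
  by rewrite ler_pdivrMr ?ltr0n // ler_peMr ?divr_ge0 // ler1n.
have : k.+1%:R != 0 :> R by rewrite pnatr_eq0.
by move: (n%:R) nR (k.+1%:R) => a a0 b b0; field; rewrite a0 b0.
Qed.

Lemma near_width (C e : R) : 0 < e -> \forall k \near \oo, C * width n k <= e.
Proof.
move=> e0; have nR : 0 < n%:R :> R by rewrite ltr0n.
exists (Num.truncn (`|C| / e)) => // k /= Ck.
apply: (@le_trans _ _ (`|C| * width n k)).
  by rewrite ler_wpM2r ?ler_norm // ltW ?width_gt0.
rewrite ler_pdivrMr ?mulr_gt0 ?ltr0n //.
have : `|C| / e < k.+1%:R.
  by apply: lt_le_trans (truncnS_gt _) _; rewrite ler_nat ltnS.
rewrite ltr_pdivrMr // => /ltW /le_trans; apply.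
rewrite mulrC ler_wpM2l ?(ltW e0) // ler_peMl //.
by have : 1 <= n%:R :> R by [rewrite ler1n]; lra.
Qed.

Lemma dotv_close x x' y d : (forall i, `|x 0 i - x' 0 i| <= d) ->
  `|dotv x y - dotv x' y| <= d * \sum_i `|y 0 i|.
Proof.
move=> xd; rewrite -sumrB mulr_sumr; apply: le_trans (ler_norm_sum _ _ _) _.
by apply: ler_sum => i _; rewrite -mulrBl normrM ler_wpM2r.
Qed.

Lemma box_average_cvg (j : nat) x0 y r : (j <= n)%N ->
  (\int[hausdorff j]_(x in flat_box j x0 (width n k) : set (borelE R n))
     (dotv (x : E) y ^+ r)) / fine (hausdorff j (flat_box j x0 (width n k)))
    @[k --> \oo] --> dotv x0 y ^+ r.
Proof.
move=> jn; apply: (average_pow_cvg (mu := hausdorff j)).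
- by move=> k; apply: closed_borel; exact: closed_flat_box.
- by move=> k; apply: hausdorff_flat_box => //; exact: width_gt0.
- exact: measurable_dotv.
move=> e e0; near=> k => x Bx.
apply: (@le_trans _ _ ((\sum_i `|y 0 i|) * width n k)); last first.
  by near: k; exact: near_width.
by rewrite mulrC dotv_close // => i; apply: flat_box_coord Bx; exact/ltW/width_gt0.
Unshelve. all: by end_near. Qed.

Lemma cap_average_cvg (j : 'I_n) y s :
  (\int[hausdorff (n - j - 1)]_(u in narrow_cone j (width n k) `&` usphere :
       set (borelE R n)) (dotv (u : E) y ^+ s)) /
     fine (hausdorff (n - j - 1) (narrow_cone j (width n k) `&` usphere))
    @[k --> \oo] --> y 0 j ^+ s.
Proof.
have w1 k : n%:R * width n k <= 1 :> R by apply: le_trans (width_le k) _; lra.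
apply: (average_pow_cvg (mu := hausdorff (n - j - 1))).
- move=> k; apply: closed_borel; apply: closedI; first exact: closed_narrow_cone.
  exact: closed_usphere.
- by move=> k; apply: hausdorff_cap => //; exact: width_gt0.
- exact: measurable_dotv.
move=> e e0; near=> k => u capu.
apply: (@le_trans _ _ ((n%:R * \sum_i `|y 0 i|) * width n k)); last first.
  by near: k; exact: near_width.
rewrite -(dotv_axis y j) (dotvC y) -mulrA [_ * width n k]mulrC mulrA.
apply: dotv_close => i; rewrite [axis _ _ _]mxE.
by apply: cap_close => //; exact: width_gt0.
Unshelve. all: by end_near. Qed.

End limits.

(** * Linear independence *)

Section exponents.
Context {R : realType}.

(** The combination is a polynomial in [t] with infinitely many roots. *)
Lemma sum_expr_independent (I : eqType) (s : seq I) (P : pred I) (b : I -> R)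
    (e : I -> nat) :
  uniq s -> {in [pred i | P i] &, injective e} ->
  (forall t : R, 0 < t -> t < 1 / 2 -> \sum_(i <- s | P i) b i * t ^+ e i = 0) ->
  forall i, i \in s -> P i -> b i = 0.
Proof.
move=> us e_inj sum0 i0 i0s Pi0.
pose q : {poly R} := \sum_(i <- s | P i) b i *: 'X^(e i).
have qE t : q.[t] = \sum_(i <- s | P i) b i * t ^+ e i.
  by rewrite horner_sum; apply: eq_bigr => i _; rewrite hornerZ hornerXn.
have q0 : q = 0.
  pose roots := [seq k.+3%:R^-1 : R | k <- iota 0 (size q)].
  apply: (@roots_geq_poly_eq0 _ _ roots); last by rewrite size_map size_iota.
    apply/allP => _ /mapP[k _ ->]; rewrite /root qE sum0 ?eqxx ?invr_gt0 ?ltr0n //.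
    by rewrite div1r ltf_pV2 ?posrE ?ltr0n // ltr_nat.
  rewrite map_inj_uniq ?iota_uniq // => k k' /invr_inj /eqP.
  by rewrite eqr_nat => /eqP [].
have := congr1 (fun f : {poly R} => f`_(e i0)) q0.
rewrite /= coef0 coef_sum big_mkcond (bigD1_seq i0) //= Pi0 coefZ coefXn eqxx mulr1.
rewrite big1 ?addr0 // => i ii0; case: ifP => // Pi.
rewrite coefZ coefXn (_ : (e i0 == e i) = false) ?mulr0 //.
by apply/negbTE; apply: contra ii0 => /eqP /e_inj <-.
Qed.

End exponents.

Section independence.
Context {R : realType} {n p : nat}.
Hypothesis n_gt0 : (0 < n)%N.
Local Notation E := 'rV[R]_n.
Local Notation idx := (Defs.index n p).

Definition exp_m (i : idx) := (sval i).1.1.1.1.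
Definition face_dim (i : idx) := (sval i).1.1.1.2.
Definition exp_r (i : idx) := (sval i).1.1.2.
Definition exp_s (i : idx) := (sval i).1.2.
Definition exp_l (i : idx) := (sval i).2.

Lemma indexP (i : idx) :
  [/\ (2 * exp_m i + 2 * exp_l i + exp_r i + exp_s i = p)%N,
      (face_dim i <= n)%N,
      (face_dim i == 0) || (face_dim i == n - 1) -> exp_l i = 0 &
      face_dim i = n -> exp_s i = 0 /\ exp_l i = 0]%N.
Proof.
case: i => -[[[[m j] r] s] l] h; rewrite /exp_m /exp_l /exp_r /exp_s /face_dim /=.
have /and4P[/eqP e jn /implyP h1 /implyP h2] := h; split=> //.
  by move=> /h1 /eqP.
by move=> /eqP /h2 /andP[/eqP -> /eqP ->].
Qed.

Lemma index_inj (i i' : idx) : face_dim i = face_dim i' -> exp_r i = exp_r i' ->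
  exp_s i = exp_s i' -> exp_l i = exp_l i' -> i = i'.
Proof.
move=> ej er es el; have [ei _ _ _] := indexP i; have [ei' _ _ _] := indexP i'.
have em : exp_m i = exp_m i' by lia.
apply: val_inj; move: em ej er es el; rewrite /exp_m /face_dim /exp_r /exp_s /exp_l /=.
by case: (sval i) (sval i') => -[[[? ?] ?] ?] ? [[[[? ?] ?] ?] ?] /= -> -> -> -> ->.
Qed.

(** The product of the constants in front of a valuation, in which the two formulas
    for [j < n] and [j = n] are merged. *)
Definition norm_const (j r s l : nat) : R :=
  if (j < n)%N then @coef R n j r s l / omega R (n - j)
  else r`!%:R^-1 * (omega R (n + 2 * l) / omega R n).

Lemma norm_const_neq0 j r s l : norm_const j r s l != 0.
Proof.
rewrite /norm_const; case: ifP => jn; apply: lt0r_neq0.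
  by apply: divr_gt0; [exact: coef_gt0 | apply: omega_gt0; lia].
apply: mulr_gt0; first by rewrite invr_gt0 ltr0n fact_gt0.
by apply: divr_gt0; apply: omega_gt0; lia.
Qed.

Definition test_polytope j x0 k : polytope R n :=
  exist _ (wedge j (width n k) x0) (wedge_is_polytope j (width n k) x0).

Definition test_borel j x0 k : borel_set R n :=
  exist _ (flat_box j x0 (width n k) : set (borelE R n))
    (closed_borel (@closed_flat_box R n j x0 (width n k))).

Definition box_integral j (x0 y : E) k r : R :=
  \int[hausdorff j]_(x in flat_box j x0 (width n k) : set (borelE R n))
     (dotv (x : E) y ^+ r).

Definition cap_integral (j : 'I_n) (y : E) k s : R :=
  \int[hausdorff (n - j - 1)]_(u in narrow_cone j (width n k) `&` usphere :
       set (borelE R n)) (dotv (u : E) y ^+ s).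

Definition value (i : idx) j x0 k y : R :=
  Qphi_family R n p i (test_polytope j x0 k) (test_borel j x0 k) (fun=> y).

Lemma value_face_dim_lt (i : idx) j x0 k y : (j <= n)%N -> (face_dim i < j)%N ->
  value i j x0 k y = 0.
Proof.
case: i => -[[[[m j'] r] s] l] h jn ij; rewrite /value /= tcast_diag /Qphi.
rewrite phi_wedge_lt //; first by rewrite tmulr0.
- exact: ltW (width_gt0 n_gt0 k).
- exact: width_le.
Qed.

Lemma value_face_dim_eq (i : idx) (j : 'I_n) x0 k y : dotv y y = 1 -> face_dim i = j ->
  value i j x0 k y = norm_const (face_dim i) (exp_r i) (exp_s i) (exp_l i) *
    (proj_sqnorm j y ^+ exp_l i *
     (box_integral j x0 y k (exp_r i) * cap_integral j y k (exp_s i))).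
Proof.
case: i => -[[[[m j'] r] s] l] h y1 ij; rewrite /value /= tcast_diag /Qphi.
rewrite /face_dim /= in ij; rewrite tmul_diag tpow_diag [metric _]y1 expr1n mul1r.
rewrite /face_dim /exp_r /exp_s /exp_l /= ij /norm_const ltn_ord.
apply: (@phi_wedge R n j (width n k) (width n k) x0) => //.
- exact: ltnW.
- exact: width_gt0.
- exact: ltW (width_gt0 n_gt0 k).
- exact: width_le.
Qed.

Lemma value_face_dim_full (i : idx) x0 k y : dotv y y = 1 -> face_dim i = n ->
  value i n x0 k y = norm_const (face_dim i) (exp_r i) (exp_s i) (exp_l i) *
    box_integral n x0 y k (exp_r i).
Proof.
move=> y1 ij; have [_ _ _ /(_ ij) [es el]] := indexP i.
case: i ij es el => -[[[[m j'] r] s] l] h.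
rewrite /face_dim /exp_r /exp_s /exp_l /= => ij es el.
rewrite /value /= tcast_diag /Qphi.
rewrite tmul_diag tpow_diag [metric _]y1 expr1n mul1r.
move: h; rewrite ij es el => h.
have := @phi_wedge_full R n n (width n k) (width n k) x0
  (ltW (width_gt0 n_gt0 k)) (width_le n_gt0 k) r 0 y erefl.
by rewrite y1 expr0 mul1r /norm_const ltnn => ->.
Qed.

Section vanishing_combination.
Variables (s : seq idx) (a : idx -> R).
Hypothesis comb0 : \sum_(i <- s) a i *: Qphi_family R n p i = 0.

Lemma sum_value_eq0 j x0 k y : \sum_(i <- s) a i * value i j x0 k y = 0.
Proof.
pose ev (f : polytope R n -> borel_set R n -> tensor R n p) : R :=
  f (test_polytope j x0 k) (test_borel j x0 k) (fun=> y).
have evD : {morph ev : f g / f + g >-> f + g} by [].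
by rewrite -[RHS]/(ev 0) -comb0 (big_morph ev evD erefl).
Qed.

(** Valuations with [face_dim i < j] do not see the test box, those with
    [j < face_dim i] carry the coefficient [0]. *)
Lemma sum_value_face_dim j x0 k y : (j <= n)%N ->
  (forall i, i \in s -> (j < face_dim i)%N -> a i = 0) ->
  \sum_(i <- s | face_dim i == j) a i * value i j x0 k y = 0.
Proof.
move=> jn a0; rewrite -[RHS](sum_value_eq0 j x0 k y) big_mkcond !big_seq /=.
apply: eq_bigr => i si; case: ltngtP => [ij|ji|//].
  by rewrite value_face_dim_lt ?mulr0.
by rewrite a0 ?mul0r.
Qed.

(** Dividing by the measures of the box and of the cap and letting both shrink
    replaces the two integrals by the values of the monomials at [x0] and at
    axis [j]. *)
Lemma vanishing_limit (j : 'I_n) (x0 y : E) :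
  (forall i, i \in s -> (j < face_dim i)%N -> a i = 0) -> dotv y y = 1 ->
  \sum_(i <- s | face_dim i == j)
    a i * norm_const (face_dim i) (exp_r i) (exp_s i) (exp_l i) *
    (proj_sqnorm j y ^+ exp_l i * (dotv x0 y ^+ exp_r i * y 0 j ^+ exp_s i)) = 0.
Proof.
move=> a0 y1.
pose hB k := fine (hausdorff j (flat_box j x0 (width n k) : set (borelE R n))).
pose hC k := fine (hausdorff (n - j - 1)
  (narrow_cone j (width n k) `&` usphere : set (borelE R n))).
pose S k := \sum_(i <- s | face_dim i == j)
    a i * norm_const (face_dim i) (exp_r i) (exp_s i) (exp_l i) *
    (proj_sqnorm j y ^+ exp_l i *
     (box_integral j x0 y k (exp_r i) / hB k * (cap_integral j y k (exp_s i) / hC k))).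
have S0 k : S k = 0.
  have := @sum_value_face_dim j x0 k y (ltnW (ltn_ord j)) a0.
  move=> /(congr1 (fun t => t * ((hB k)^-1 * (hC k)^-1))); rewrite mul0r => <-.
  rewrite mulr_suml; apply: eq_bigr => i /eqP ij.
  by rewrite value_face_dim_eq //; ring.
have Slim : S k @[k --> \oo] --> \sum_(i <- s | face_dim i == j)
    a i * norm_const (face_dim i) (exp_r i) (exp_s i) (exp_l i) *
    (proj_sqnorm j y ^+ exp_l i * (dotv x0 y ^+ exp_r i * y 0 j ^+ exp_s i)).
  apply: cvg_big => [|i _]; first exact: add_continuous.
  apply: cvgM; first exact: cvg_cst.
  apply: cvgM; first exact: cvg_cst.
  apply: cvgM; first exact: box_average_cvg (ltnW (ltn_ord j)).
  exact: cap_average_cvg.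
by rewrite -(cvg_lim _ Slim) // (_ : S = fun=> 0) ?lim_cst //; exact/funext.
Qed.

Lemma vanishing_limit_full (x0 y : E) : dotv y y = 1 ->
  \sum_(i <- s | face_dim i == n)
    a i * norm_const (face_dim i) (exp_r i) (exp_s i) (exp_l i) *
    dotv x0 y ^+ exp_r i = 0.
Proof.
move=> y1.
pose hB k := fine (hausdorff n (flat_box n x0 (width n k) : set (borelE R n))).
pose S k := \sum_(i <- s | face_dim i == n)
    a i * norm_const (face_dim i) (exp_r i) (exp_s i) (exp_l i) *
    (box_integral n x0 y k (exp_r i) / hB k).
have S0 k : S k = 0.
  have a0 i : i \in s -> (n < face_dim i)%N -> a i = 0.
    by have [_ ] := indexP i; lia.
  have := @sum_value_face_dim n x0 k y (leqnn n) a0.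
  move=> /(congr1 (fun t => t * (hB k)^-1)); rewrite mul0r => <-.
  rewrite mulr_suml; apply: eq_bigr => i /eqP ij.
  by rewrite value_face_dim_full //; ring.
have Slim : S k @[k --> \oo] --> \sum_(i <- s | face_dim i == n)
    a i * norm_const (face_dim i) (exp_r i) (exp_s i) (exp_l i) *
    dotv x0 y ^+ exp_r i.
  apply: cvg_big => [|i _]; first exact: add_continuous.
  apply: cvgM; first exact: cvg_cst.
  exact: box_average_cvg.
by rewrite -(cvg_lim _ Slim) // (_ : S = fun=> 0) ?lim_cst //; exact/funext.
Qed.

End vanishing_combination.

End independence.

Section test_vectors.
Context {R : realType} {n : nat}.
Local Notation E := 'rV[R]_n.

Lemma proj_sqnormE j (y : E) : (j <= n)%N ->
  proj_sqnorm j y = \sum_(i < n | (i < j)%N) y 0 i ^+ 2.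
Proof.
move=> jn; pose z : E := \row_i if (i < j)%N then y 0 i else 0.
rewrite /proj_sqnorm (@oproj_eq _ _ _ _ z).
- rewrite /dotv [RHS]big_mkcond; apply: eq_bigr => i _; rewrite mxE.
  by case: ifP => _; rewrite -expr2 ?expr0n.
- by apply/coord_spaceP => // i ji; rewrite mxE ltnNge ji.
move=> w /(coord_spaceP _ jn) w0; rewrite /dotv big1 // => i _; rewrite !mxE.
by have [ij|/w0 ->] := ltnP i j; rewrite ?subrr ?mul0r ?mulr0.
Qed.

Lemma three_axes (alpha beta gamma : R) (i j k : 'I_n) :
  (i == j -> alpha = 0) -> (k == j -> gamma = 0) -> i != k ->
  let y : E := alpha *: axis i + beta *: axis j + gamma *: axis k in
  [/\ dotv y y = alpha ^+ 2 + beta ^+ 2 + gamma ^+ 2, y 0 j = beta &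
    forall m : 'I_n, m != j -> m != k -> y 0 m = alpha * (m == i)%:R].
Proof.
move=> ij kj ik y.
have yE m : y 0 m = alpha * (m == i)%:R + beta * (m == j)%:R + gamma * (m == k)%:R.
  by rewrite !mxE.
have yj : y 0 j = beta.
  rewrite yE eqxx mulr1; have [e|_] := eqVneq j i; last first.
    have [e|_] := eqVneq j k; last by rewrite !mulr0 add0r addr0.
    by rewrite kj ?e // mul0r mulr0 add0r addr0.
  have [e'|_] := eqVneq j k; last by rewrite ij ?e // !mul0r mulr0 add0r addr0.
  by move: ik; rewrite -e e' eqxx.
split=> // [|m mj mk]; last first.
  by rewrite yE (negbTE mj) (negbTE mk) !mulr0 !addr0.
have -> : dotv y y = alpha * y 0 i + beta * y 0 j + gamma * y 0 k.
  by rewrite {2}/y !dotvDr !dotvZr !dotv_axis.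
rewrite yj !yE !eqxx (negbTE ik) (eq_sym k) (negbTE ik) !mulr0 !mulr1.
have [/eqP /ij ->|_] := eqVneq i j; have [/eqP /kj ->|_] := eqVneq k j;
  rewrite ?mulr0 ?mulr1 ?mul0r; ring.
Qed.

(** For [0 < j < n - 1] there are three mutually orthogonal directions to dispose
    of: one along the face, axis [j], and a third one that restores unit length.
    For [j = 0] the first is missing and for [j = n - 1] the third. *)
Lemma exists_test_vector (j : 'I_n) (t : R) (K : nat) : (1 < n)%N ->
  0 < t -> t < 1 / 2 -> (0 < K)%N ->
  exists y : E, [/\ dotv y y = 1, y 0 j = t ^+ K &
    (0 < j < n - 1)%N -> proj_sqnorm j y = t ^+ 2].
Proof.
move=> n1 t0 t2 K0; have n0 : (0 < n)%N by lia.
have nl : (n - 1 < n)%N by lia.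
pose o := Ordinal n0; pose l := Ordinal nl.
have ol : o != l by rewrite -val_eqE /=; lia.
have tK : t ^+ K <= t.
  by case: K K0 => // K _; rewrite exprS ler_piMr ?exprn_ile1 ?ltW //; lra.
have tK0 : 0 <= t ^+ K by rewrite exprn_ge0 // ltW.
have beta2 : (t ^+ K) ^+ 2 <= 1 / 4.
  apply: (@le_trans _ _ (t ^+ 2)); first by rewrite lerXn2r ?nnegrE // ltW.
  by rewrite expr2; nra.
have t24 : t ^+ 2 <= 1 / 4 by rewrite expr2; nra.
pose alpha : R := if o == j then 0 else
  if l == j then Num.sqrt (1 - (t ^+ K) ^+ 2) else t.
pose gamma : R := if l == j then 0 else Num.sqrt (1 - alpha ^+ 2 - (t ^+ K) ^+ 2).
have aj : o == j -> alpha = 0 by rewrite /alpha => ->.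
have gj : l == j -> gamma = 0 by rewrite /gamma => ->.
have [yy yj ym] := three_axes (t ^+ K) aj gj ol.
exists (alpha *: axis o + t ^+ K *: axis j + gamma *: axis l); split=> //.
  rewrite yy /gamma /alpha; have [oj|_] := eqVneq o j.
    rewrite -oj (eq_sym l) (negbTE ol) sqr_sqrtr; first by ring.
    rewrite expr0n /=; lra.
  have [_|_] := eqVneq l j; first by rewrite sqr_sqrtr; [ring | lra].
  by rewrite sqr_sqrtr; [ring | lra].
move=> /andP[j0 jl]; rewrite proj_sqnormE; last exact: ltnW.
rewrite (bigD1 o) //= big1 ?addr0 => [|m /andP[mj mo]]; last first.
  rewrite ym ?(negbTE mo) ?mulr0 ?expr0n //.
    by rewrite -val_eqE /= ltn_eqF.
  by rewrite -val_eqE /= ltn_eqF // (ltn_trans mj).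
rewrite ym ?eqxx ?mulr1 //; last by rewrite -val_eqE /= ltn_eqF.
rewrite /alpha -!val_eqE /= ltn_eqF // gtn_eqF //.
Qed.

End test_vectors.

(** Uniqueness of digits in base [K]. *)
Lemma encode_inj (K l l' s s' r r' : nat) :
  (2 * l < K -> 2 * l' < K -> s < K -> s' < K ->
   2 * l + K * (s + K * r) = 2 * l' + K * (s' + K * r') ->
   [/\ l = l', s = s' & r = r'])%N.
Proof.
have digit a b c d : (a < K -> b < K -> a + K * c = b + K * d -> a = b /\ c = d)%N.
  move=> aK bK e; have K0 : (0 < K)%N by lia.
  have /= := congr1 (modn^~ K) e.
  rewrite (addnC a) (addnC b) (mulnC K c) (mulnC K d) !modnMDl !modn_small // => ab.
  split=> //.
  by move: e; rewrite ab => /addnI /eqP; rewrite eqn_pmul2l // => /eqP.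
move=> lK l'K sK s'K /(digit _ _ _ _ lK l'K) [ll' e].
by have [-> ->] := digit _ _ _ _ sK s'K e; split=> //; lia.
Qed.

(* For n = 1 and p >= 2 the family is linearly dependent: every u in S^0
   satisfies u^2 = Q, so phi_0^{0,2,0} is a multiple of Q phi_0^{0,0,0}. *)
Theorem theorem10 (R : realType) (n p : nat) (n_gt0 : (0 < n)%N)
    (n1_p : n = 1%N -> (p <= 1)%N) :
  linearly_independent (Qphi_family R n p).
Proof.
move=> s a us comb0.
have norm_neq0 (i : Defs.index n p) :
    @norm_const R n (face_dim i) (exp_r i) (exp_s i) (exp_l i) != 0.
  exact: norm_const_neq0.
pose b i := a i * @norm_const R n (face_dim i) (exp_r i) (exp_s i) (exp_l i).
have b0 i : b i = 0 -> a i = 0.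
  by move/eqP; rewrite mulf_eq0 (negbTE (norm_neq0 i)) orbF => /eqP.
suff main d : forall i, i \in s -> (n - face_dim i)%N = d -> a i = 0.
  by move=> i si; exact: (main _ i si erefl).
elim/ltn_ind: d => d IH i0 si0 dE.
set j := face_dim i0 in dE.
have jn : (j <= n)%N by have [_] := indexP i0.
have above i : i \in s -> (j < face_dim i)%N -> a i = 0.
  move=> si ji; have [_ iN _ _] := indexP i.
  by apply: (IH (n - face_dim i)%N) => //; lia.
have conclude (e : Defs.index n p -> nat) :
    {in [pred i | face_dim i == j] &, injective e} ->
    (forall t : R, 0 < t -> t < 1 / 2 ->
       \sum_(i <- s | face_dim i == j) b i * t ^+ e i = 0) -> a i0 = 0.
  move=> e_inj sum0; apply/b0.
  exact: (@sum_expr_independent R _ s [pred i | face_dim i == j] b e us e_inj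
    sum0 i0 si0 (eqxx j)).
(* In the full-dimensional case only [exp_r] is free. *)
have [jE|jlt] := eqVneq j n.
  apply: (conclude (@exp_r n p)) => [i i' /eqP ij /eqP i'j er|t t0 _].
    have [_ _ _ /(_ (etrans ij jE)) [s0 l0]] := indexP i.
    have [_ _ _ /(_ (etrans i'j jE)) [s0' l0']] := indexP i'.
    by apply: index_inj => //; congruence.
  pose y : 'rV[R]_n := axis (Ordinal n_gt0).
  have y1 : dotv y y = 1 by rewrite dotv_axis mxE eqxx.
  rewrite -[RHS](vanishing_limit_full n_gt0 comb0 (t *: y) y1) jE; apply: eq_bigr => i _.
  by rewrite (dotvC (t *: y)) dotvZr y1 mulr1.
have jltn : (j < n)%N by lia.
pose jo := Ordinal jltn.
(* On the line, [p <= 1] makes [exp_s] a function of [exp_r]. *)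
have [n1|n2] := eqVneq n 1%N.
  apply: (conclude (@exp_r n p)) => [i i' /eqP ij /eqP i'j er|t t0 _].
    have [ei _ li _] := indexP i; have [ei' _ li' _] := indexP i'.
    have := n1_p n1.
    have l0 : exp_l i = 0%N by apply: li; rewrite ij; lia.
    have l0' : exp_l i' = 0%N by apply: li'; rewrite i'j; lia.
    move=> p1; apply: index_inj => //; last by rewrite l0 l0'.
      by rewrite ij i'j.
    by have : exp_r i = exp_r i' := er; lia.
  pose y : 'rV[R]_n := axis jo.
  have y1 : dotv y y = 1 by rewrite dotv_axis mxE eqxx.
  rewrite -[RHS](vanishing_limit n_gt0 comb0 (j := jo) (t *: y) above y1).
  apply: eq_bigr => i /eqP ij; have [_ _ li _] := indexP i.
  rewrite (dotvC (t *: y)) dotvZr y1 mulr1 [y 0 jo]mxE eqxx expr1n mulr1.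
  rewrite /b; congr (_ * _); rewrite (li _) ?expr0 ?mul1r //.
  by rewrite ij; lia.
(* The exponents are at most [p], hence digits in base [K]. *)
pose K := p.+1.
apply: (conclude (fun i => 2 * exp_l i + K * (exp_s i + K * exp_r i))%N).
  move=> i i' /eqP ij /eqP i'j.
  have [ei _ _ _] := indexP i; have [ei' _ _ _] := indexP i'.
  move=> /encode_inj [|||| el es er]; rewrite /K; try lia.
  by apply: index_inj => //; congruence.
move=> t t0 t2.
have [||y [y1 yj py]] := @exists_test_vector R n jo t K _ t0 t2 _; try lia.
have x0y : dotv (t ^+ (K * K) *: y) y = t ^+ (K * K).
  by rewrite dotvC dotvZr y1 mulr1.
rewrite -[RHS](vanishing_limit n_gt0 comb0 (j := jo) (t ^+ (K * K) *: y) above y1).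
apply: eq_bigr => i /eqP ij; rewrite /b x0y yj; congr (_ * _).
have -> : proj_sqnorm jo y ^+ exp_l i = t ^+ (2 * exp_l i).
  have [_ _ li _] := indexP i; rewrite ij in li.
  have [j0|] := boolP (0 < j < n - 1)%N; first by rewrite py // -exprM.
  by rewrite negb_and => jbd; rewrite li ?muln0 ?expr0 //; lia.
by rewrite -!exprM -!exprD; congr (_ ^+ _); ring.
Qed.
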